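(* Let $p=3$, $\nu\in[0,1]$, $q=3+\nu$, and suppose that $f$ satisfies the $(3,\nu)$-Hölder condition on $\mathcal X$ with constant $L_{3,\nu}>0$. Let $\mu,L,M>0$ be constants with $\mu I\preceq\nabla^2f(x)\preceq LI$ for all $x\in\mathcal X$ and $\|\nabla^2f(x)-\nabla^2f(y)\|_2\le M\|x-y\|$ for all $x,y\in\mathcal X$ (they exist under these assumptions). Let $\rho\in(0,1)$ and $0<\omega<\frac{c_3\mu}{L}\rho^2(1-\rho^{q/(q-1)})$, where $c_3=1/4$. Put $$C_3=\frac{M}{2\mu}+\sqrt{\frac2\mu}\left(1+\frac{MD}{2\mu^{3/2}}\right)^2,\qquad K_3=\min\left\{k\ge0\ \middle|\ g_k\le\frac\mu8C_3^{-2}\right\}.$$ Let $\{x_k\}$ be generated by the switched damped Newton Frank–Wolfe method with switching iteration $K=K_3$ and exponent $a=4$ (with either inner procedure FW or AFW). Then $K_3$ is finite, and either the sequence reaches $x^\star$ in finitely many iterations, or $$\|x_{k+1}-x^\star\|\le C_3\|x_k-x^\star\|^2\qquad\text{for every }k\ge K_3.$$ Moreover, in the latter case there exists a constant $\widetilde C_3>0$ such that $$f(x_{k+1})-f(x^\star)\le\widetilde C_3\,(f(x_k)-f(x^\star))^2\qquad\text{for all }k\ge K_3,$$ and both $\|x_k-x^\star\|$ and $f(x_k)-f(x^\star)$ converge to $0$ Q-quadratically.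
   Context: Setting. $\mathcal X\subset\mathbb R^n$ is a nonempty compact convex set; $f:\mathbb R^n\to\mathbb R$ is convex and twice differentiable with $\nabla^2 f(x)$ positive definite for all $x\in\mathcal X$; $x^\star$ is a minimizer of $f$ over $\mathcal X$. $\|\cdot\|$ is the Euclidean norm and $\|\cdot\|_2$ the induced operator norm of matrices; $\|y\|_x=\langle\nabla^2f(x)y,y\rangle^{1/2}$, $\|h\|_x^*=\langle h,\nabla^2f(x)^{-1}h\rangle^{1/2}$; for positive definite $H$, $\|y\|_H=\langle Hy,y\rangle^{1/2}$; $D=\sup_{x,y\in\mathcal X}\|x-y\|_x$. The FW gap is $g_k=\max_{v\in\mathcal X}\langle\nabla f(x_k),x_k-v\rangle$. $(3,\nu)$-Hölder condition: $f$ is three times differentiable; for all $x,y\in\mathcal X$, $\sup_{z_1,z_2,z_3\ne0}\frac{|(\nabla^3f(x)-\nabla^3f(y))[z_1,z_2,z_3]|}{\|z_1\|_x\|z_2\|_x\|z_3\|_x}\le L_{3,\nu}\|x-y\|_x^\nu$; and $\Gamma_{3,\mathcal X}=\sup_{x\in\mathcal X}\sup_{z_1,z_2,z_3\ne0}\frac{|\nabla^3f(x)[z_1,z_2,z_3]|}{\|z_1\|_x\|z_2\|_x\|z_3\|_x}$ is finite with $\Gamma_{3,\mathcal X}\le2(L_{3,\nu}/(1+\nu))^{1/(1+\nu)}$. Constants. $\kappa_\omega=\frac{1+\sqrt{1+4\omega(1+\rho^{-2})}}{2}$; $B_q=(9L_{3,\nu})^{1/(q-1)}\kappa_\omega^{(q-2)/(q-1)}$.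 Convergence order. A nonnegative sequence $b_k\to0$ converges Q-quadratically if $b_{k+1}\le Cb_k^2$ eventually for some $C>0$. Inner procedure FW$(h,H,u,\eta)$. Set $u_0=u$. For $t=0,1,\dots$: take $v_t\in\arg\min_{v\in\mathcal X}\langle h+H(u_t-u),v\rangle$; if $\langle h+H(u_t-u),u_t-v_t\rangle\le\eta$ return $u_t$; otherwise $\gamma_t=\min\{1,\langle h+H(u_t-u),u_t-v_t\rangle/\|v_t-u_t\|_H^2\}$ and $u_{t+1}=(1-\gamma_t)u_t+\gamma_tv_t$. Inner procedure AFW$(h,H,u,\eta,\mathcal S,\lambda)$ (away-step FW). Here $\mathcal S$ is a finite set of extreme points of $\mathcal X$ and $\lambda$ positive weights on $\mathcal S$ summing to 1 with $u=\sum_{v\in\mathcal S}\lambda_vv$; linear minimization over $\mathcal X$ is assumed to return extreme points. Set $u_0=u,\mathcal S_0=\mathcal S,\lambda_0=\lambda$. For $t=0,1,\dots$, with $G=h+H(u_t-u)$: take $v_t^{FW}\in\arg\min_{v\in\mathcal X}\langle G,v\rangle$; if $\langle G,u_t-v_t^{FW}\rangle\le\eta$ return $(u_t,\mathcal S_t,\lambda_t)$; take $v_t^A\in\arg\max_{v\in\mathcal S_t}\langle G,v\rangle$. If $\langle G,u_t-v_t^{FW}\rangle\ge\langle G,v_t^A-u_t\rangle$ (FW step) put $d_t=u_t-v_t^{FW}$, $\gamma_{t,\max}=1$; otherwise (away step) put $d_t=v_t^A-u_t$, $\gamma_{t,\max}=\lambda_{v_t^A,t}/(1-\lambda_{v_t^A,t})$.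 Set $\gamma_t=\min\{\gamma_{t,\max},\langle G,d_t\rangle/\|d_t\|_H^2\}$, $u_{t+1}=u_t-\gamma_td_t$. Weights: in an FW step multiply all weights by $1-\gamma_t$ and add $\gamma_t$ to the weight of $v_t^{FW}$ (inserting it in the active set if needed; if $\gamma_t=1$ the active set becomes $\{v_t^{FW}\}$); in an away step multiply all weights by $1+\gamma_t$, subtract $\gamma_t$ from that of $v_t^A$, and remove $v_t^A$ from the active set if its weight becomes 0. Residual backtracking update at iteration $k$ (parameters $\rho\in(0,1)$, $\omega>0$, $\bar\theta_0>0$, $\tau>1$; $s_{-1}=0$, $\Delta_{-1}=0$). Set $r_k=\nabla f(x_k)+s_{k-1}$, $\Delta_k=\max\{\|r_k\|_{x_k}^*,\rho\Delta_{k-1}\}$, $\eta_k=\frac{\omega\Delta_k^2}{1+B_q\Delta_k^{(q-2)/(q-1)}}$. For $j=0,1,2,\dots$: $\theta_{k,j}=\min\{\tau^j\bar\theta_k,B_q\Delta_k^{(q-2)/(q-1)}\}$, $\alpha_{k,j}=1/(1+\theta_{k,j})$; $x_{k,j}$ is the point returned by the inner procedure with $h=\nabla f(x_k)$, $H=\alpha_{k,j}^{-1}\nabla^2f(x_k)$, $u=x_k$, $\eta=\eta_k$ (for AFW also the current active set and weights of $x_k$); $s_{k,j}=-\nabla f(x_k)-\alpha_{k,j}^{-1}\nabla^2f(x_k)(x_{k,j}-x_k)$, $w_{k,j}=\nabla f(x_k)+s_{k,j}$, $r_{k+1,j}=\nabla f(x_{k,j})+s_{k,j}$. Accept the first $j$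 with $\langle r_{k+1,j},\nabla^2f(x_k)^{-1}w_{k,j}\rangle\ge\frac{c_3}{\alpha_{k,j}\theta_{k,j}}\|r_{k+1,j}\|_{x_k}^{*2}$ and set $\theta_k=\theta_{k,j}$, $x_{k+1}=x_{k,j}$, $s_k=s_{k,j}$, $\bar\theta_{k+1}=\theta_k/\tau$ (for AFW, carry over the accepted active set and weights). Switched method with switching iteration $K$ and exponent $a$. Start at $x_0\in\mathcal X$ (for AFW, an extreme point returned by linear minimization, with active set $\{x_0\}$). For $k<K$ use the residual backtracking update. For $k\ge K$: if $g_k=0$, terminate; otherwise run the iterations of the inner procedure with $h=\nabla f(x_k)$, $H=\nabla^2f(x_k)$, $u=x_k$ (i.e. stepsize $\alpha_k=1$), producing $u_0=x_k,u_1,\dots$, but replace its stopping test by the following: with $\Psi_1(u;x_k)=f(x_k)+\langle\nabla f(x_k),u-x_k\rangle+\frac12\|u-x_k\|_{x_k}^2$, $G_t=\max_{v\in\mathcal X}\langle\nabla\Psi_1(u_t;x_k),u_t-v\rangle$, $M_t=f(x_k)-\Psi_1(u_t;x_k)$, stop at $\ell_k(a)=\min\{t\ge0\mid G_t\le(M_t/\|\nabla f(x_k)\|)^a\}$, and set $x_{k+1}=u_{\ell_k(a)}$. *)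

(* Defs.v *)
From HB Require Import structures.
From mathcomp Require Import all_boot all_order all_algebra finmap.
From mathcomp Require Import boolp classical_sets functions reals ereal.
From mathcomp Require Import interval_inference topology normedtype sequences.
From mathcomp Require Import derive convex exp.

Set Implicit Arguments.
Unset Strict Implicit.
Unset Printing Implicit Defensive.

Import Order.TTheory GRing.Theory Num.Theory.
Import numFieldNormedType.Exports.

Local Open Scope classical_set_scope.
Local Open Scope ring_scope.

(* Vectors are row vectors, so that [hess] is literally the library's Jacobian
   of the gradient; a symmetric matrix H acts on y as [y *m H]. The norm `|_|
   of the library on 'rV[R]_n is the sup norm, hence the separate [enorm];
   topology and differentiability do not depend on this choice. *)
Section Euclidean.
Context {R : realType} {n : nat}.
Local Notation V := 'rV[R]_n.
Local Notation M := 'M[R]_n.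
Implicit Types (u v x y h G : V) (H A B : M) (X : set V).

Definition dot u v : R := \sum_(i < n) u 0 i * v 0 i.

Definition enorm u : R := Num.sqrt (dot u u).

Definition opnorm A : R := sup [set enorm (z *m A) | z in [set z | enorm z <= 1]].

Definition posdef H := H^T = H /\ forall z, z != 0 -> 0 < dot (z *m H) z.

Definition loewner A B :=
  (B - A)^T = B - A /\ forall z, 0 <= dot (z *m (B - A)) z.

Definition hnorm H y : R := Num.sqrt (dot (y *m H) y).

Definition dual_hnorm H h : R := Num.sqrt (dot h (h *m invmx H)).

Definition extreme_point X v := X v /\
  forall a b (t : R), X a -> X b -> 0 < t < 1 ->
    v = t *: a + (1 - t) *: b -> a = v /\ b = v.

Definition argmin_lin X G v := X v /\ forall w, X w -> dot G v <= dot G w.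

Definition fw_gap X G u : R := sup [set dot G (u - v) | v in X].

End Euclidean.

Section Smoothness.
Context {R : realType} {n : nat}.
Local Notation V := 'rV[R]_n.
Implicit Types (f : V -> R) (x y : V) (X : set V).

Definition grad f x : V := \row_(i < n) 'D_(delta_mx 0 i) f x.

Definition hess f x : 'M[R]_n := 'J (grad f) x.

Definition D3 f x (z1 z2 z3 : V) : R := dot (z2 *m 'D_z1 (hess f) x) z3.

Definition twice_differentiable f :=
  (forall x, differentiable f x) /\ (forall x, differentiable (grad f) x).

Definition thrice_differentiable f :=
  twice_differentiable f /\ forall x, differentiable (hess f) x.

Definition lnorm f x y : R := hnorm (hess f x) y.

Definition dual_lnorm f x h : R := dual_hnorm (hess f x) h.

Definition diameter X f : R :=
  sup [set d | exists x y, [/\ X x, X y & d = lnorm f x (x - y)]].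

(* The suprema below are taken in \bar R, where they always make sense. *)
Definition trilinear_norm f x (T : V -> V -> V -> R) : \bar R :=
  ereal_sup [set e | exists z1 z2 z3 : V, [/\ z1 != 0, z2 != 0, z3 != 0 &
    e = (`|T z1 z2 z3| / (lnorm f x z1 * lnorm f x z2 * lnorm f x z3))%:E]].

Definition Gamma3 X f : \bar R :=
  ereal_sup [set trilinear_norm f x (D3 f x) | x in X].

Definition holder3 X f (nu L3 : R) :=
  [/\ thrice_differentiable f,
      forall x y, X x -> X y ->
        (trilinear_norm f x
           (fun z1 z2 z3 => D3 f x z1 z2 z3 - D3 f y z1 z2 z3)%R
         <= (L3 * lnorm f x (x - y) `^ nu)%:E)%E,
      (Gamma3 X f < +oo)%E &
      (Gamma3 X f <= (2 * (L3 / (1 + nu)) `^ (1 + nu)^-1)%:E)%E].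

Definition hess_bounds X f (mu L M : R) :=
  (forall x, X x -> loewner mu%:M (hess f x) /\ loewner (hess f x) L%:M) /\
  (forall x y, X x -> X y -> opnorm (hess f x - hess f y) <= M * enorm (x - y)).

End Smoothness.

Section InnerProcedures.
Context {R : realType} {n : nat}.
Local Notation V := 'rV[R]_n.
Implicit Types (X : set V) (h G v : V) (H : 'M[R]_n).

Inductive inner_proc := FW | AFW.

(* [weight] is 0 outside [active]. FW leaves these two fields untouched and
   never reads them. *)
Record iterate := Iterate { pt : V; active : {fset V}; weight : V -> R }.
Implicit Types y : iterate.

Definition lmo X (m : inner_proc) G v :=
  argmin_lin X G v /\ (m = AFW -> extreme_point X v).

Definition fw_next H G y v : iterate :=
  let u := pt y in
  let g := Num.min 1 (dot G (u - v) / hnorm H (v - u) ^+ 2) in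
  Iterate ((1 - g) *: u + g *: v) (active y) (weight y).

Definition afw_fw_next H G y v : iterate :=
  let u := pt y in
  let d := u - v in
  let g := Num.min 1 (dot G d / hnorm H d ^+ 2) in
  Iterate (u - g *: d)
    (if g == 1 then [fset v]%fset else (v |` active y)%fset)
    (fun w => (1 - g) * weight y w + g * (w == v)%:R).

Definition afw_away_next H G y v : iterate :=
  let u := pt y in
  let d := v - u in
  let gmax := weight y v / (1 - weight y v) in
  let g := Num.min gmax (dot G d / hnorm H d ^+ 2) in
  let wt := fun w => (1 + g) * weight y w - g * (w == v)%:R in
  Iterate (u - g *: d)
    (if wt v == 0 then (active y `\ v)%fset else active y) wt.

Definition inner_step (m : inner_proc) H G y v y' :=
  match m with
  | FW => y' = fw_next H G y v
  | AFW => exists vA,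
      [/\ vA \in active y,
          forall w, w \in active y -> dot G w <= dot G vA &
          y' = if dot G (vA - pt y) <= dot G (pt y - v)
               then afw_fw_next H G y v else afw_away_next H G y vA]
  end.

(* Started at y0 with linear term h and matrix H, the inner procedure with
   stopping test [stop u_t v_t] stops and returns y1. *)
Definition inner_returns X m h H (stop : V -> V -> Prop) (y0 y1 : iterate) :=
  exists (T : nat) (y : nat -> iterate) (v : nat -> V),
  let G t := h + (pt (y t) - pt y0) *m H in
  [/\ y 0%N = y0,
      y T = y1,
      forall t, (t <= T)%N -> lmo X m (G t) (v t),
      forall t, (t < T)%N ->
        ~ stop (pt (y t)) (v t) /\ inner_step m H (G t) (y t) (v t) (y t.+1) &
      stop (pt (y T)) (v T)].

Definition gap_test h H (u0 : V) (eta : R) (u v : V) :=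
  dot (h + (u - u0) *m H) (u - v) <= eta.

End InnerProcedures.

Section Method.
Context {R : realType} {n : nat}.
Local Notation V := 'rV[R]_n.
Implicit Types (X : set V) (f : V -> R) (x : V) (m : inner_proc).

Definition kappa (omega rho : R) : R :=
  (1 + Num.sqrt (1 + 4 * omega * (1 + rho ^- 2))) / 2.

Definition Bq (q L3 omega rho : R) : R :=
  (9 * L3) `^ (q - 1)^-1 * kappa omega rho `^ ((q - 2) / (q - 1)).

(* Data available at the start of iteration k: x_k with its active set,
   s_{k-1}, Delta_{k-1} and \bar\theta_k. *)
Record mstate := MState {
  cur : @iterate R n; sprev : V; Dprev : R; thetabar : R }.
Implicit Types s : mstate.

Definition damped_step X f m (q L3 c3 rho omega tau : R) s s' :=
  let x := pt (cur s) in
  let h := grad f x in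
  let H0 := hess f x in
  let Delta := Num.max (dual_lnorm f x (h + sprev s)) (rho * Dprev s) in
  let beta := Bq q L3 omega rho * Delta `^ ((q - 2) / (q - 1)) in
  let eta := omega * Delta ^+ 2 / (1 + beta) in
  let theta j := Num.min (tau ^+ j * thetabar s) beta in
  let alpha j := (1 + theta j)^-1 in
  let H j := (alpha j)^-1 *: H0 in
  exists (J : nat) (y : nat -> @iterate R n),
  let xj j := pt (y j) in
  let sj j := - h - (xj j - x) *m H j in
  let w j := h + sj j in
  let r j := grad f (xj j) + sj j in
  let accept j := c3 / (alpha j * theta j) * dual_lnorm f x (r j) ^+ 2
                  <= dot (r j) (w j *m invmx H0) in
  [/\ forall j, (j <= J)%N ->
        inner_returns X m h (H j) (gap_test h (H j) x eta) (cur s) (y j),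
      forall j, (j < J)%N -> ~ accept j,
      accept J &
      s' = MState (y J) (sj J) Delta (theta J / tau)].

Definition Psi1 f x (u : V) : R :=
  f x + dot (grad f x) (u - x) + lnorm f x (u - x) ^+ 2 / 2.

Definition newton_test X f x (a : nat) (u _ : V) :=
  fw_gap X (grad (Psi1 f x) u) u
  <= ((f x - Psi1 f x u) / enorm (grad f x)) ^+ a.

(* Termination (when the FW gap is 0) is modelled by a constant continuation.
   The fields [sprev], [Dprev], [thetabar] are no longer used. *)
Definition newton_step X f m (a : nat) s s' :=
  let x := pt (cur s) in
  if fw_gap X (grad f x) x == 0 then s' = s
  else inner_returns X m (grad f x) (hess f x) (newton_test X f x a)
         (cur s) (cur s').

Definition start X m (theta0 : R) s :=
  [/\ X (pt (cur s)),
      m = AFW ->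
        [/\ exists c, lmo X m c (pt (cur s)),
            active (cur s) = [fset pt (cur s)]%fset &
            weight (cur s) = fun w => (w == pt (cur s))%:R],
      sprev s = 0, Dprev s = 0 & thetabar s = theta0].

(* K = None stands for K = +oo: the method never switches. *)
Definition switched (K : option nat) (k : nat) : bool :=
  if K is Some K0 then (K0 <= k)%N else false.

Definition generated X f m (q L3 c3 rho omega theta0 tau : R)
    (K : option nat) (a : nat) (x : nat -> V) :=
  exists s : nat -> mstate,
  [/\ forall k, x k = pt (cur (s k)),
      start X m theta0 (s 0%N) &
      forall k, if switched K k then newton_step X f m a (s k) (s k.+1)
                else damped_step X f m q L3 c3 rho omega tau (s k) (s k.+1)].

(* min {k | P k}, or None (i.e. +oo) if this set is empty. *)
Definition first_index (P : pred nat) : option nat :=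
  if pselect (exists k, P k) is left exP then Some (ex_minn exP) else None.

Definition C3 (mu M D : R) : R :=
  M / (2 * mu)
  + Num.sqrt (2 / mu) * (1 + M * D / (2 * mu `^ (3 / 2))) ^+ 2.

Definition K3 X f (mu C : R) (x : nat -> V) : option nat :=
  first_index (fun k => fw_gap X (grad f (x k)) (x k) <= mu / 8 * C ^- 2).

End Method.

Definition q_quadratic {R : realType} (b : nat -> R) :=
  [/\ forall k, 0 <= b k,
      b @ \oo --> (0 : R) &
      exists C : R, 0 < C /\ \forall k \near \oo, b k.+1 <= C * b k ^+ 2].

(* Main.v *)
Require Import Defs.
From HB Require Import structures.
From mathcomp Require Import all_boot all_order all_algebra finmap.
From mathcomp Require Import boolp classical_sets functions reals ereal.
From mathcomp Require Import interval_inference topology normedtype sequences.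
From mathcomp Require Import derive convex exp.
From mathcomp Require Import ring lra.

(**
  Damped phase. The acceptance rule gives
  [c3 / theta_k * |r_{k+1}|^2 <= <r_{k+1}, x_k - x_{k+1}>], which together with
  the inner stopping test (at [v = x_k]) and convexity bounds
  [f x_k - f x_{k+1}] from below by
  [c3 / (B Delta_k^sigma) * |r_{k+1}|^2 - omega / B * Delta_k^p], where
  [p = q / (q - 1)] and [sigma = 2 - p]. For [A = c3 mu rho^2 / (L B)] the
  potential [f x_k + A Delta_k^p] then decreases by a fixed multiple of
  [Delta_k^p], so [Delta_k] gets arbitrarily small; the Frank-Wolfe gap at
  [x_{k+1}] is at most [eta_k] plus a multiple of [Delta_{k+1}].

  Newton phase. With [d = |x_k - xs|], the variational inequalities at [u] and
  [xs] give [mu |u - xs|^2 <= G + M / 2 d^2 |u - xs|] for a point [u] of model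
  gap [G]. The exact Newton point shows that the model decrease is at most
  [|grad f x_k| (1 + M D / (2 mu^(3/2))) d], and the line search keeps it
  nonnegative, so the stopping test with exponent 4 makes [G] of order [d^4].
*)

Set Implicit Arguments.
Unset Strict Implicit.
Unset Printing Implicit Defensive.

Import Order.TTheory GRing.Theory Num.Theory.
Import numFieldNormedType.Exports.

Local Open Scope classical_set_scope.
Local Open Scope ring_scope.

(** * Dot products and Loewner bounds *)

Section Euclidean.
Context {R : realType} {n : nat}.
Implicit Types (u v w x y z : 'rV[R]_n) (A B H : 'M[R]_n) (a : R).

Lemma dotE u v : dot u v = (u *m v^T) 0 0.
Proof. by rewrite /dot mxE; apply: eq_bigr => i _; rewrite mxE. Qed.

Lemma dotC u v : dot u v = dot v u.
Proof. by apply: eq_bigr => i _; rewrite mulrC. Qed.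

Lemma dotDl u v w : dot (u + v) w = dot u w + dot v w.
Proof. by rewrite !dotE mulmxDl mxE. Qed.

Lemma dotNl u w : dot (- u) w = - dot u w.
Proof. by rewrite !dotE mulNmx mxE. Qed.

Lemma dotZl a u w : dot (a *: u) w = a * dot u w.
Proof. by rewrite !dotE -scalemxAl mxE. Qed.

Lemma dotBl u v w : dot (u - v) w = dot u w - dot v w.
Proof. by rewrite dotDl dotNl. Qed.

Lemma dotDr u v w : dot w (u + v) = dot w u + dot w v.
Proof. by rewrite dotC dotDl !(dotC w). Qed.

Lemma dotNr u w : dot w (- u) = - dot w u.
Proof. by rewrite dotC dotNl dotC. Qed.

Lemma dotZr a u w : dot w (a *: u) = a * dot w u.
Proof. by rewrite dotC dotZl dotC. Qed.

Lemma dotBr u v w : dot w (u - v) = dot w u - dot w v.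
Proof. by rewrite dotDr dotNr. Qed.

Lemma dot0l w : dot 0 w = 0.
Proof. by rewrite dotE mul0mx mxE. Qed.

Lemma dot0r w : dot w 0 = 0.
Proof. by rewrite dotC dot0l. Qed.

Lemma dot_mulmx u v A : dot (u *m A) v = dot u (v *m A^T).
Proof. by rewrite !dotE trmx_mul trmxK mulmxA. Qed.

Lemma dot_sym u v A : A^T = A -> dot (u *m A) v = dot (v *m A) u.
Proof. by move=> sA; rewrite dot_mulmx sA dotC. Qed.

Lemma dot_mulmxBr u v A B : dot (u *m (A - B)) v = dot (u *m A) v - dot (u *m B) v.
Proof. by rewrite mulmxBr dotBl. Qed.

Lemma dot_mulmxDl u w v A : dot ((u + w) *m A) v = dot (u *m A) v + dot (w *m A) v.
Proof. by rewrite mulmxDl dotDl. Qed.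

Lemma dot_mulmxZl a u v A : dot ((a *: u) *m A) v = a * dot (u *m A) v.
Proof. by rewrite -scalemxAl dotZl. Qed.

Lemma dot_mulmxZr a u v A : dot (u *m (a *: A)) v = a * dot (u *m A) v.
Proof. by rewrite -scalemxAr dotZl. Qed.

Lemma dotvv_ge0 u : 0 <= dot u u.
Proof. by apply: sumr_ge0 => i _; rewrite -expr2 sqr_ge0. Qed.

Lemma dotvv_eq0 u : (dot u u == 0) = (u == 0).
Proof.
apply/eqP/eqP => [u0|->]; last exact: dot0l.
apply/rowP => i; rewrite mxE; apply/eqP; rewrite -sqrf_eq0 expr2.
apply/eqP; move: i (isT : predT i); apply/psumr_eq0P => // i _.
by rewrite -expr2 sqr_ge0.
Qed.

Lemma enorm_ge0 u : 0 <= enorm u.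
Proof. exact: sqrtr_ge0. Qed.

Lemma sqr_enorm u : enorm u ^+ 2 = dot u u.
Proof. by rewrite sqr_sqrtr// dotvv_ge0. Qed.

Lemma enorm_eq0 u : (enorm u == 0) = (u == 0).
Proof. by rewrite -sqrf_eq0 sqr_enorm dotvv_eq0. Qed.

Lemma enorm0 : enorm (0 : 'rV[R]_n) = 0.
Proof. by apply/eqP; rewrite enorm_eq0. Qed.

Lemma enorm_gt0 u : (0 < enorm u) = (u != 0).
Proof. by rewrite lt_neqAle enorm_ge0 eq_sym enorm_eq0 andbT. Qed.

Lemma enormZ a u : enorm (a *: u) = `|a| * enorm u.
Proof. by rewrite /enorm dotZl dotZr mulrA -expr2 sqrtrM ?sqr_ge0// sqrtr_sqr. Qed.

Lemma enormN u : enorm (- u) = enorm u.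
Proof. by rewrite /enorm dotNl dotNr opprK. Qed.

Lemma enormB u v : enorm (u - v) = enorm (v - u).
Proof. by rewrite -enormN opprB. Qed.

Lemma dot_le u v : dot u v <= enorm u * enorm v.
Proof.
have [->|u0] := eqVneq u 0; first by rewrite dot0l enorm0 mul0r.
have [->|v0] := eqVneq v 0; first by rewrite dot0r enorm0 mulr0.
move: u0 v0; rewrite -!enorm_gt0 => u0 v0.
have := dotvv_ge0 ((enorm v) *: u - (enorm u) *: v).
rewrite !dotBl !dotBr !dotZl !dotZr -!sqr_enorm (dotC v u) => h.
have : 0 <= 2 * (enorm u * enorm v) * (enorm u * enorm v - dot u v) by lra.
by rewrite pmulr_rge0 ?subr_ge0// !mulr_gt0.
Qed.

Lemma normr_dot_le u v : `|dot u v| <= enorm u * enorm v.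
Proof. by rewrite ler_norml lerNl -dotNl -(enormN u) dot_le enormN dot_le. Qed.

Lemma ler_enormD u v : enorm (u + v) <= enorm u + enorm v.
Proof.
rewrite -ler_sqr ?nnegrE ?addr_ge0 ?enorm_ge0// sqr_enorm.
rewrite sqrrD !sqr_enorm !dotDl !dotDr (dotC v u).
have := dot_le u v; lra.
Qed.

Lemma ler_coord_enorm u i : `|u 0 i| <= enorm u.
Proof.
rewrite -ler_sqr ?nnegrE ?enorm_ge0// sqr_enorm real_normK ?num_real//.
rewrite /dot (bigD1 i)//= -expr2 lerDl sumr_ge0// => j _.
by rewrite -expr2 sqr_ge0.
Qed.

Lemma opnorm_mulmx A z : enorm (z *m A) <= opnorm A * enorm z.
Proof.
pose c : R := Num.sqrt (\sum_j enorm (\row_i A i j) ^+ 2).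
have bd y : enorm (y *m A) <= c * enorm y.
  rewrite -ler_sqr ?nnegrE ?mulr_ge0 ?enorm_ge0 ?sqrtr_ge0//.
  rewrite exprMn sqr_enorm sqr_sqrtr; last first.
    by apply: sumr_ge0 => j _; rewrite sqr_ge0.
  rewrite mulr_suml; apply: ler_sum => j _.
  rewrite -expr2 -exprMn -(real_normK (num_real _)) ler_sqr ?nnegrE//; last first.
    by rewrite mulr_ge0 ?enorm_ge0.
  rewrite mulrC; apply: le_trans (normr_dot_le _ _).
  by rewrite mxE /dot; under [in leRHS]eq_bigr do rewrite mxE.
have hs : has_sup [set enorm (y *m A) | y in [set y | enorm y <= 1]].
  split; first by exists (enorm (0 *m A)); exists 0 => //=; rewrite enorm0.
  exists c => _ [y /= y1 <-]; apply: le_trans (bd y) _.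
  by rewrite ler_piMr// sqrtr_ge0.
have [->|z0] := eqVneq z 0; first by rewrite mul0mx enorm0 mulr0.
move: z0; rewrite -enorm_gt0 => z0.
rewrite -ler_pdivrMr//; apply: (sup_upper_bound hs).
exists ((enorm z)^-1 *: z) => /=; rewrite ?enormZ ?ger0_norm ?invr_ge0 ?enorm_ge0//.
  by rewrite mulVf ?gt_eqF.
by rewrite -scalemxAl enormZ ger0_norm ?invr_ge0 ?enorm_ge0// mulrC.
Qed.

Lemma opnorm_le A (c : R) : 0 <= c ->
  (forall z, enorm (z *m A) <= c * enorm z) -> opnorm A <= c.
Proof.
move=> c0 hc; apply: ge_sup => [|_ [z /= z1 <-]].
  by exists (enorm (0 *m A)); exists 0 => //=; rewrite enorm0.
by apply: le_trans (hc z) _; rewrite ler_piMr.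
Qed.

Lemma dot_opnorm_le A z w :
  `|dot (z *m A) w| <= opnorm A * enorm z * enorm w.
Proof.
by apply: le_trans (normr_dot_le _ _) _; rewrite ler_wpM2r ?enorm_ge0 ?opnorm_mulmx.
Qed.

Lemma enorm_le_dot v (c : R) : 0 <= c ->
  (forall w, dot v w <= c * enorm w) -> enorm v <= c.
Proof.
move=> c0 /(_ v); rewrite -sqr_enorm expr2.
have := enorm_ge0 v; rewrite le_eqVlt => /predU1P[<-//|v0].
by rewrite ler_pM2r.
Qed.

End Euclidean.

Section Loewner.
Context {R : realType} {n : nat}.
Implicit Types (y z h : 'rV[R]_n) (H : 'M[R]_n) (mu L : R).

Lemma sqr_hnorm H y : 0 <= dot (y *m H) y -> hnorm H y ^+ 2 = dot (y *m H) y.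
Proof. by move=> h; rewrite sqr_sqrtr. Qed.

Lemma loewner_sym mu H : loewner mu%:M H -> H^T = H.
Proof.
by move=> [+ _]; rewrite linearB/= tr_scalar_mx => /addIr.
Qed.

Lemma loewner_lower mu H z : loewner mu%:M H -> mu * enorm z ^+ 2 <= dot (z *m H) z.
Proof.
by move=> [_ /(_ z)]; rewrite mulmxBr mul_mx_scalar dotBl dotZl sqr_enorm subr_ge0.
Qed.

Lemma loewner_upper L H z : loewner H L%:M -> dot (z *m H) z <= L * enorm z ^+ 2.
Proof.
by move=> [_ /(_ z)]; rewrite mulmxBr mul_mx_scalar dotBl dotZl sqr_enorm subr_ge0.
Qed.

Lemma loewner_psd mu H z : 0 < mu -> loewner mu%:M H -> 0 <= dot (z *m H) z.
Proof.
move=> mu0 /(loewner_lower z); apply: le_trans.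
by rewrite mulr_ge0 ?sqr_ge0 ?ltW.
Qed.

Lemma loewner_unitmx mu H : 0 < mu -> loewner mu%:M H -> H \in unitmx.
Proof.
move=> mu0 muH; rewrite -row_free_unit -kermx_eq0; apply/eqP/row_matrixP => i.
rewrite row0; apply/eqP; rewrite -enorm_eq0 -sqrf_eq0; apply/eqP.
have := loewner_lower (row i (kermx H)) muH.
rewrite -row_mul mulmx_ker row0 dot0l => h.
by apply/eqP; rewrite eq_le sqr_ge0 andbT -(pmulr_rle0 _ mu0).
Qed.

Section Dual.
Variables (mu L : R) (H : 'M[R]_n).
Hypotheses (mu0 : 0 < mu) (muH : loewner mu%:M H).

Let Hinv h : (h *m invmx H) *m H = h.
Proof. by rewrite -mulmxA mulVmx ?mulmx1// (loewner_unitmx mu0). Qed.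

Lemma sqr_dual_hnorm h : dual_hnorm H h ^+ 2 = dot h (h *m invmx H).
Proof.
rewrite sqr_sqrtr// dotC -{2}(Hinv h) dotC.
exact: loewner_psd mu0 muH.
Qed.

Lemma dual_hnorm_upper h : mu * dual_hnorm H h ^+ 2 <= enorm h ^+ 2.
Proof.
rewrite sqr_dual_hnorm; set z := h *m invmx H.
have := loewner_lower z muH; rewrite Hinv.
have := dotvv_ge0 (h - mu *: z).
rewrite !dotBl !dotBr !dotZl !dotZr !sqr_enorm (dotC z h) => h1 h2.
have : mu * (mu * dot z z) <= mu * dot h z by rewrite ler_pM2l.
lra.
Qed.

Hypotheses (L0 : 0 < L) (HL : loewner H L%:M).

Lemma dual_hnorm_lower h : enorm h ^+ 2 <= L * dual_hnorm H h ^+ 2.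
Proof.
rewrite sqr_dual_hnorm; set z := h *m invmx H.
have sH := loewner_sym muH.
have := loewner_upper h HL.
have := loewner_psd (h - L *: z) mu0 muH.
rewrite mulmxBl -scalemxAl Hinv !dotBl !dotBr !dotZl !dotZr.
rewrite (dot_sym h z sH) Hinv !sqr_enorm => h1 h2.
by rewrite -(ler_pM2l L0); lra.
Qed.

End Dual.
End Loewner.

(** * Taylor bounds along segments *)

Section Line.
Context {R : realType}.

Lemma is_derive_line (V W : normedModType R) (F : V -> W) (x v : V) (t : R) :
  differentiable F (x + t *: v) ->
  is_derive t 1 (fun s : R => F (x + s *: v)) ('D_v F (x + t *: v)).
Proof.
move=> dF.
have E : (fun h : R => h^-1 *:
      (((fun s : R => F (x + s *: v)) \o shift t) (h *: 1) - F (x + t *: v))) =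
    (fun h : R => h^-1 *:
      ((F \o shift (x + t *: v)) (h *: v) - F (x + t *: v))).
  apply/funext => h /=; congr (_ *: (F _ - _)).
  by rewrite [h *: 1]mulr1 scalerDl addrCA.
have := @diff_derivable _ _ _ F _ v dF; rewrite /derivable -E => dv.
by apply: DeriveDef => //; rewrite /derive E.
Qed.

Lemma is_derive_mx (m n : nat) (F : R -> 'M[R]_(m, n)) (t : R) dF i j :
  is_derive t 1 F dF -> is_derive t 1 (fun s => F s i j) (dF i j).
Proof.
move=> [dF1 <-]; apply: DeriveDef; first by move/derivable_mxP : dF1.
by rewrite derive_mx// mxE.
Qed.

Lemma is_derive_dotl (n : nat) (F : R -> 'rV[R]_n) (t : R) dF w :
  is_derive t 1 F dF -> is_derive t 1 (fun s => dot (F s) w) (dot dF w).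
Proof.
move=> dFt.
have -> : (fun s => dot (F s) w) =
    \sum_(i < n) ((w 0 i) \*: (fun s => F s 0 i)).
  apply/funext => s; rewrite /dot fct_sumE; apply: eq_bigr => i _ /=.
  by rewrite mulrC.
have -> : dot dF w = \sum_(i < n) (w 0 i *: dF 0 i).
  by apply: eq_bigr => i _; rewrite mulrC.
by apply: is_derive_sum => i; apply: is_deriveZ; exact: is_derive_mx.
Qed.

Lemma is_derive_mulmxr (n : nat) (F : R -> 'M[R]_n) (t : R) dF (z : 'rV[R]_n) :
  is_derive t 1 F dF -> is_derive t 1 (fun s => z *m F s) (z *m dF).
Proof.
move=> dFt.
have E s : z *m F s = \sum_(i < n) (z 0 i *: row i (F s)).
  by rewrite mulmx_sum_row.
have -> : (fun s => z *m F s) = \sum_(i < n) ((z 0 i) \*: (fun s => row i (F s))).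
  by apply/funext => s; rewrite fct_sumE mulmx_sum_row.
rewrite mulmx_sum_row; apply: is_derive_sum => i; apply: is_deriveZ.
have dr j : is_derive t 1 (fun s => row i (F s) 0 j) (dF i j).
  rewrite (_ : (fun _ => _) = (fun s => F s i j)); last first.
    by apply/funext => s; rewrite mxE.
  exact: is_derive_mx.
have dv : derivable (fun s => row i (F s)) t 1.
  by apply/derivable_mxP => a j; rewrite ord1; have [] := dr j.
apply: DeriveDef => //; rewrite derive_mx//; apply/rowP => j; rewrite !mxE.
by rewrite derive_val.
Qed.

Lemma mean_value01 (phi dphi : R -> R) :
  (forall t : R, is_derive t 1 phi (dphi t)) ->
  exists2 t, 0 < t < 1 & phi 1 - phi 0 = dphi t.
Proof.
move=> dp; have [|t] := @MVT R phi dphi 0 1 ltr01 (fun t _ => dp t).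

  by apply: (@derivable_within_continuous R R) => t _; have [] := dp t.
by rewrite in_itv/= subr0 mulr1 => ? ?; exists t.
Qed.

End Line.

Section Gradient.
Context {R : realType} {n : nat}.
Implicit Types (f : 'rV[R]_n -> R) (x y v w z : 'rV[R]_n) (X : set 'rV[R]_n).

Lemma derive_grad f x v : differentiable f x -> 'D_v f x = dot (grad f x) v.
Proof.
move=> df; rewrite deriveE// {1}(row_sum_delta v) linear_sum /dot.
by apply: eq_bigr => i _; rewrite linearZ /= mxE deriveE// mulrC.
Qed.

Lemma gradE f x i : grad f x 0 i = 'D_(delta_mx 0 i) f x.
Proof. by rewrite mxE. Qed.

Lemma derive_hess f x v : differentiable (grad f) x ->
  'D_v (grad f) x = v *m hess f x.
Proof. exact: deriveEjacobian. Qed.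

End Gradient.

(* Unfolding these makes conversion tests between distinct atoms very slow. *)
#[global] Opaque grad hess.

Section Convexity.
Context {R : realType} {n : nat}.
Implicit Types (f : 'rV[R]_n -> R) (x y v w z : 'rV[R]_n) (X : set 'rV[R]_n).

Lemma convex_comb X x y (t : R) : convex_set X -> X x -> X y ->
  0 <= t <= 1 -> X (t *: x + (1 - t) *: y).
Proof.
move=> cX Xx Xy /andP[t0 t1].
by have := cX x y (Itv01 t0 t1); rewrite !inE => /(_ Xx Xy).
Qed.

Lemma convex_segment X x y (t : R) : convex_set X -> X x -> X y ->
  0 <= t <= 1 -> X (x + t *: (y - x)).
Proof.
move=> cX Xx Xy t01.
have -> : x + t *: (y - x) = t *: y + (1 - t) *: x.
  by rewrite scalerBl scalerBr scale1r addrCA.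
exact: convex_comb.
Qed.

Lemma is_derive_f_line f x v (t : R) : (forall x, differentiable f x) ->
  is_derive t 1 (fun s : R => f (x + s *: v)) (dot (grad f (x + t *: v)) v).
Proof. by move=> df; rewrite -derive_grad//; exact: is_derive_line. Qed.

Lemma is_derive_grad_line f x v w (t : R) :
  (forall x, differentiable (grad f) x) ->
  is_derive t 1 (fun s : R => dot (grad f (x + s *: v)) w)
    (dot (v *m hess f (x + t *: v)) w).
Proof.
move=> dg; rewrite -derive_hess//.
by apply: is_derive_dotl; exact: is_derive_line.
Qed.

Section Bounds.
Variables (X : set 'rV[R]_n) (f : 'rV[R]_n -> R) (mu L M : R).
Hypotheses (cX : convex_set X) (tdf : twice_differentiable f).
Hypotheses (mu0 : 0 < mu) (M0 : 0 < M) (hb : hess_bounds X f mu L M).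

Lemma grad_strongly_monotone x y : X x -> X y ->
  mu * enorm (y - x) ^+ 2 <= dot (grad f y - grad f x) (y - x).
Proof.
move=> Xx Xy.
have [t /andP[t0 t1]] := mean_value01
  (fun t => is_derive_grad_line x (y - x) (y - x) t tdf.2).
rewrite scale1r scale0r addr0 subrKC -dotBl => ->.
apply: loewner_lower; apply: (hb.1 _ _).1; apply: convex_segment => //.
by rewrite !ltW.
Qed.

Lemma grad_monotone_upper x y : X x -> X y ->
  dot (grad f y - grad f x) (y - x) <= L * enorm (y - x) ^+ 2.
Proof.
move=> Xx Xy.
have [t /andP[t0 t1]] := mean_value01
  (fun t => is_derive_grad_line x (y - x) (y - x) t tdf.2).
rewrite scale1r scale0r addr0 subrKC -dotBl => ->.
apply: loewner_upper; apply: (hb.1 _ _).2; apply: convex_segment => //.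
by rewrite !ltW.
Qed.

Lemma gradient_inequality x y : X x -> X y -> dot (grad f x) (y - x) <= f y - f x.
Proof.
move=> Xx Xy.
have [t /andP[t0 t1]] := mean_value01
  (fun t => is_derive_f_line x (y - x) t tdf.1).
rewrite scale1r scale0r addr0 subrKC => ->.
rewrite -subr_ge0 -dotBl.
have Xt : X (x + t *: (y - x)) by apply: convex_segment => //; rewrite !ltW.
have := grad_strongly_monotone Xx Xt; rewrite addrAC subrr add0r dotZr.
have h : 0 <= mu * enorm (t *: (y - x)) ^+ 2 by rewrite mulr_ge0 ?sqr_ge0 ?ltW.
by move/(le_trans h); rewrite pmulr_rge0.
Qed.

Lemma grad_taylor x y w : X x -> X y ->
  dot (grad f y - grad f x - (y - x) *m hess f x) w
  <= M / 2 * enorm (y - x) ^+ 2 * enorm w.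
Proof.
have aux (p q a b c k : R) :
  p - b - c - q = a - b - k -> a - b <= k -> p - q - b <= c by lra.
move=> Xx Xy; set c := M / 2 * enorm (y - x) ^+ 2 * enorm w.
pose phi s := dot (grad f (x + s *: (y - x))) w
  - dot ((y - x) *m hess f x) w * s - c * s ^+ 2.
have [t /andP[t0 t1]] : exists2 t, 0 < t < 1 & phi 1 - phi 0 =
    dot ((y - x) *m hess f (x + t *: (y - x))) w
    - dot ((y - x) *m hess f x) w - c * (2 * t).
  apply: mean_value01 => t; rewrite /phi.
  have h1 := is_derive_grad_line x (y - x) w t tdf.2.
  have h2 : is_derive t 1 (fun s : R => dot ((y - x) *m hess f x) w * s)
      (dot ((y - x) *m hess f x) w).
    by apply: is_derive_eq; rewrite [LHS]mulr1.
  have h3 : is_derive t 1 (fun s : R => c * s ^+ 2) (c * (2 * t)).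
    by apply: is_derive_eq; rewrite /GRing.scale /=; ring.
  exact: (@is_deriveB _ _ _ _ _ _ _ _ _ (@is_deriveB _ _ _ _ _ _ _ _ _ h1 h2) h3).
rewrite /phi scale1r scale0r addr0 subrKC mulr0 expr0n mulr0 !subr0 !mulr1 expr1n.
rewrite mulr1.
have : X (x + t *: (y - x)) by apply: convex_segment => //; rewrite !ltW.
have : (x + t *: (y - x)) - x = t *: (y - x) by rewrite addrAC subrr add0r.
move: (x + t *: (y - x)) => z zx Xz E.
suff : dot ((y - x) *m (hess f z - hess f x)) w <= c * (2 * t).
  rewrite dot_mulmxBr !dotBl; move: E.
  exact: aux.
apply: le_trans (ler_norm _) _; apply: le_trans (dot_opnorm_le _ _ _) _.
have := hb.2 _ _ Xz Xx; rewrite zx enormZ gtr0_norm// => h.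
have -> : c * (2 * t) = M * (t * enorm (y - x)) * enorm (y - x) * enorm w.
  by rewrite /c; field.
by rewrite !ler_wpM2r ?enorm_ge0.
Qed.

Section Minimizer.
Variable xs : 'rV[R]_n.
Hypotheses (Xxs : X xs) (xs_min : forall y, X y -> f xs <= f y).

Lemma minimizer_stationary y : X y -> 0 <= dot (grad f xs) (y - xs).
Proof.
move=> Xy; rewrite leNgt; apply/negP => h.
set a := dot (grad f xs) (y - xs) in h *.
set c := L * enorm (y - xs) ^+ 2.
have c0 : 0 <= c.
  apply: le_trans (grad_monotone_upper Xxs Xy).
  apply: le_trans (grad_strongly_monotone Xxs Xy).
  by rewrite mulr_ge0 ?sqr_ge0 ?ltW.
pose t := - a / (- a + c).
have ac : 0 < - a + c by rewrite ltr_wpDr// oppr_gt0.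
have t0 : 0 < t by rewrite divr_gt0 ?oppr_gt0.
have t1 : t <= 1 by rewrite ler_pdivrMr// mul1r lerDl.
have Xt : X (xs + t *: (y - xs)) by apply: convex_segment => //; rewrite t1 ltW.
have h1 := gradient_inequality Xt Xxs.
have h2 := grad_monotone_upper Xxs Xt.
have := xs_min Xt.
move: h1 h2; rewrite opprD addrA subrr add0r dotNr addrAC subrr add0r.
rewrite !dotZr dotBl enormZ exprMn real_normK ?num_real// -/a.
rewrite (mulrCA L) -/c expr2 => h1 h2 h3.
have : 0 <= t * dot (grad f (xs + t *: (y - xs))) (y - xs) by lra.
rewrite pmulr_rge0// => h4.
have : t * (dot (grad f (xs + t *: (y - xs))) (y - xs) - a) <= t * (t * c) by lra.
rewrite ler_pM2l// => h5.
have : t * (- a + c) = - a by rewrite mulfVK// gt_eqF.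
have : 0 < t * - a by rewrite mulr_gt0// oppr_gt0.
lra.
Qed.

End Minimizer.
End Bounds.
End Convexity.

(** * Existence of the Hessian bounds *)

Section HessBounds.
Context {R : realType} {n : nat}.
Implicit Types (f : 'rV[R]_n -> R) (x y v w z : 'rV[R]_n) (X : set 'rV[R]_n).

Lemma continuous_coord (T : topologicalType) (m p : nat) (F : T -> 'M[R]_(m, p)) i j :
  continuous F -> continuous (fun t => F t i j).
Proof.
move=> cF t; apply: (@continuous_comp _ _ _ F (fun A : 'M[R]_(m, p) => A i j)).
  exact: cF.
exact: coord_continuous.
Qed.

Lemma continuous_bigsum (T : topologicalType) (I : Type) (s : seq I) (F : I -> T -> R) :
  (forall i, continuous (F i)) -> continuous (fun t => \sum_(i <- s) F i t).
Proof.
move=> cF; elim: s => [|i s IH].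
  under eq_fun do rewrite big_nil; exact: cst_continuous.
under eq_fun do rewrite big_cons; move=> t.
by apply: cvgD; [exact: cF | exact: IH].
Qed.

Lemma continuous_dot (T : topologicalType) (F G : T -> 'rV[R]_n) :
  continuous F -> continuous G -> continuous (fun t => dot (F t) (G t)).
Proof.
move=> cF cG; apply: continuous_bigsum => i t.
by apply: cvgM; apply: continuous_coord.
Qed.

Lemma continuous_quad (T : topologicalType) (F : T -> 'rV[R]_n) (G : T -> 'M[R]_n) :
  continuous F -> continuous G -> continuous (fun t => dot (F t *m G t) (F t)).
Proof.
move=> cF cG.
have -> : (fun t => dot (F t *m G t) (F t)) =
    fun t => \sum_(i < n) (\sum_(k < n) F t 0 k * G t k i) * F t 0 i.
  by apply/funext => t; apply: eq_bigr => i _; rewrite mxE.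
apply: continuous_bigsum => i t; apply: cvgM; last exact: continuous_coord.
by apply: continuous_bigsum => k ?; apply: cvgM; exact: continuous_coord.
Qed.

Lemma ler_norm_enorm z : `|z| <= enorm z.
Proof.
rewrite /Num.Def.normr/= mx_normrE (bigmax_le _ (enorm_ge0 z))//= => -[i j] _.
by rewrite ord1; exact: ler_coord_enorm.
Qed.

Lemma enorm_le_norm z : enorm z <= Num.sqrt n%:R * `|z|.
Proof.
rewrite -ler_sqr ?nnegrE ?mulr_ge0 ?sqrtr_ge0 ?enorm_ge0//.
rewrite sqr_enorm exprMn sqr_sqrtr// /dot -[X in _ <= X%:R * _](card_ord n).
rewrite mulr_natl -sumr_const; apply: ler_sum => i _.
rewrite -expr2 -(real_normK (num_real (z 0 i))) ler_sqr ?nnegrE//.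
rewrite [leRHS]/Num.Def.normr/= mx_normrE.
exact: (le_bigmax _ (fun ij : 'I_1 * 'I_n => `|z ij.1 ij.2|) (0, i)).
Qed.

Lemma compact_sphere : compact [set z : 'rV[R]_n | enorm z = 1].
Proof.
apply: bounded_closed_compact.
  exists 1; split; first exact: num_real.
  move=> e e1 z /= z1; apply: le_trans (ler_norm_enorm z) _.
  by rewrite z1 ltW.
have -> : [set z : 'rV[R]_n | enorm z = 1] =
    (fun z : 'rV[R]_n => dot z z) @^-1` [set 1].
  apply/seteqP; split => z /=; first by rewrite -sqr_enorm => ->; rewrite expr1n.
  by rewrite /enorm => ->; rewrite sqrtr1.
apply: preimage_closed; last exact: closed_eq.
by move=> z _; apply: continuous_dot => x; exact: cvg_id.
Qed.

Lemma compact_hess_form X f : compact X -> continuous (hess f) ->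
  (forall x, X x -> posdef (hess f x)) ->
  exists mu L : R, [/\ 0 < mu, 0 < L &
    forall x z, X x -> mu * enorm z ^+ 2 <= dot (z *m hess f x) z <= L * enorm z ^+ 2].
Proof.
move=> cX ch pd.
have cXS := compact_setX cX compact_sphere.
set A := _ `*` _ in cXS.
have [/set0P A0|A0] := pselect (A != set0); last first.
  exists 1, 1; split=> // x z Xx.
  have [->|z0] := eqVneq z 0.
    by rewrite enorm0 expr0n mulr0 mul0mx dot0l lexx.
  exfalso; apply: A0; apply/set0P; exists (x, (enorm z)^-1 *: z); split => //=.
  rewrite enormZ ger0_norm ?invr_ge0 ?enorm_ge0// mulVf//.
  by rewrite enorm_eq0.
pose q (p : 'rV[R]_n * 'rV[R]_n) : R := dot (p.2 *m hess f p.1) p.2.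
have cq : {within A, continuous q}.
  apply: continuous_subspaceT; apply: continuous_quad => p.
    exact: cvg_snd.
  by apply: continuous_comp; [exact: cvg_fst|exact: ch].
have [[x1 z1]] := compact_EVT_min A0 cXS cq.
rewrite inE => -[/= Xx1 z11] qmin.
have [[x2 z2]] := compact_EVT_max A0 cXS cq.
rewrite inE => -[/= Xx2 z21] qmax.
have z10 : z1 != 0 by rewrite -enorm_eq0 z11 oner_eq0.
have z20 : z2 != 0 by rewrite -enorm_eq0 z21 oner_eq0.
exists (q (x1, z1)), (q (x2, z2)); split.
- exact: (pd _ Xx1).2.
- exact: (pd _ Xx2).2.
move=> x z Xx.
have [->|z0] := eqVneq z 0.
  by rewrite enorm0 expr0n !mulr0 mul0mx dot0l lexx.
have e0 : 0 < enorm z by rewrite enorm_gt0.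
have Axz : (x, (enorm z)^-1 *: z) \in A.
  rewrite inE; split => //=.
  by rewrite enormZ ger0_norm ?invr_ge0 ?enorm_ge0// mulVf// gt_eqF.
have -> : dot (z *m hess f x) z = q (x, (enorm z)^-1 *: z) * enorm z ^+ 2.
  rewrite /q /= -scalemxAl dotZl dotZr; field.
  by rewrite gt_eqF.
by rewrite !ler_pM2r ?exprn_gt0// qmin ?qmax.
Qed.

Lemma D3_bound X f : (Gamma3 X f < +oo)%E ->
  exists2 G : R, 0 <= G & forall x z1 z2 z3, X x ->
    (forall z, z != 0 -> 0 < lnorm f x z) ->
    z1 != 0 -> z2 != 0 -> z3 != 0 ->
    `|D3 f x z1 z2 z3| <= G * (lnorm f x z1 * lnorm f x z2 * lnorm f x z3).
Proof.
move=> Gfin.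
have ub x z1 z2 z3 : X x -> z1 != 0 -> z2 != 0 -> z3 != 0 ->
    ((`|D3 f x z1 z2 z3| / (lnorm f x z1 * lnorm f x z2 * lnorm f x z3))%:E
      <= Gamma3 X f)%E.
  move=> Xx z10 z20 z30.
  apply: (@le_trans _ _ (trilinear_norm f x (D3 f x))).
    by apply: ereal_sup_ubound; exists z1, z2, z3.
  by apply: ereal_sup_ubound; exists x.
exists (Num.max 0 (fine (Gamma3 X f))); first by rewrite le_max lexx.
move=> x z1 z2 z3 Xx pos z10 z20 z30.
have := ub x z1 z2 z3 Xx z10 z20 z30.
rewrite -ler_pdivrMr ?mulr_gt0 ?pos// le_max.
case: (Gamma3 X f) Gfin => [r _|//|_]; last by [].
by rewrite lee_fin => ->; rewrite orbT.
Qed.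

Lemma hess_bounds_exist X f : X !=set0 -> compact X -> convex_set X ->
  thrice_differentiable f -> (Gamma3 X f < +oo)%E ->
  (forall x, X x -> posdef (hess f x)) ->
  exists mu L M : R, [/\ 0 < mu, 0 < L, 0 < M & hess_bounds X f mu L M].
Proof.
move=> X0 cX cvX [tdf dH] Gfin pd.
have cH : continuous (hess f) by move=> x; apply: differentiable_continuous.
have [mu [L [mu0 L0 hq]]] := compact_hess_form cX cH pd.
have [G G0 hG] := D3_bound Gfin.
have lnE x z : X x -> lnorm f x z ^+ 2 = dot (z *m hess f x) z.
  move=> Xx; rewrite sqr_hnorm//.
  have /andP[+ _] := hq x z Xx; apply: le_trans.
  by rewrite mulr_ge0 ?sqr_ge0 ?ltW.
have ln_gt0 x : X x -> forall z, z != 0 -> 0 < lnorm f x z.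
  move=> Xx z z0; rewrite /lnorm /hnorm sqrtr_gt0.
  exact: (pd _ Xx).2.
have ln_le x z : X x -> lnorm f x z <= Num.sqrt L * enorm z.
  move=> Xx; rewrite -ler_sqr ?nnegrE ?mulr_ge0 ?sqrtr_ge0 ?enorm_ge0//.
  rewrite lnE// exprMn sqr_sqrtr ?(ltW L0)//.
  by have /andP[] := hq x z Xx.
pose c := G * (Num.sqrt L * Num.sqrt L * Num.sqrt L).
have c0 : 0 <= c by rewrite !mulr_ge0 ?sqrtr_ge0.
exists mu, L, (c + 1); split => //; first by rewrite ltr_wpDl.
split=> [x Xx|x y Xx Xy].
  have sH : (hess f x)^T = hess f x := (pd x Xx).1.
  split; split.
  - by rewrite linearB/= tr_scalar_mx sH.
  - move=> z; rewrite dot_mulmxBr mul_mx_scalar dotZl -sqr_enorm subr_ge0.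
    by have /andP[] := hq x z Xx.
  - by rewrite linearB/= tr_scalar_mx sH.
  - move=> z; rewrite dot_mulmxBr mul_mx_scalar dotZl -sqr_enorm subr_ge0.
    by have /andP[] := hq x z Xx.
have D3le z w t : 0 <= t <= 1 ->
    `|D3 f (y + t *: (x - y)) (x - y) z w| <= c * enorm (x - y) * enorm z * enorm w.
  move=> t01.
  have Xt := convex_segment cvX Xy Xx t01.
  have rhs0 : 0 <= c * enorm (x - y) * enorm z * enorm w.
    by rewrite !mulr_ge0 ?enorm_ge0.
  have [xy0|xy0] := eqVneq (x - y) 0.
    by rewrite /D3 xy0 derive0 mulmx0 dot0l normr0 -xy0.
  have [z0|z0] := eqVneq z 0; first by rewrite /D3 z0 mul0mx dot0l normr0 -z0.
  have [w0|w0] := eqVneq w 0; first by rewrite /D3 w0 dot0r normr0 -w0.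
  apply: le_trans (hG _ _ _ _ Xt (ln_gt0 _ Xt) xy0 z0 w0) _.
  have -> : c * enorm (x - y) * enorm z * enorm w = G *
      ((Num.sqrt L * enorm (x - y)) * (Num.sqrt L * enorm z) * (Num.sqrt L * enorm w)).
    by rewrite /c; ring.
  rewrite ler_wpM2l// ler_pM ?mulr_ge0 ?sqrtr_ge0 ?ln_le//.
  by rewrite ler_pM ?sqrtr_ge0 ?ln_le.
apply: opnorm_le => [|z]; first by rewrite mulr_ge0 ?enorm_ge0// addr_ge0.
apply: enorm_le_dot => [|w].
  by rewrite !mulr_ge0 ?enorm_ge0// addr_ge0.
have dphi (t : R) : is_derive t 1 (fun s : R => dot (z *m hess f (y + s *: (x - y))) w)
    (D3 f (y + t *: (x - y)) (x - y) z w).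
  by apply: is_derive_dotl; apply: is_derive_mulmxr; exact: is_derive_line.
have [t /andP[t0 t1]] := mean_value01 dphi.
rewrite scale1r scale0r addr0 subrKC dot_mulmxBr => ->.
apply: le_trans (ler_norm _) _; apply: le_trans (D3le z w t _) _.
  by rewrite !ltW.
by rewrite !ler_wpM2r ?enorm_ge0// lerDl.
Qed.

End HessBounds.

Lemma compact_enorm_bounded {R : realType} {n : nat} (X : set 'rV[R]_n) :
  compact X -> exists2 D : R, 0 < D & forall x y, X x -> X y -> enorm (x - y) <= D.
Proof.
move=> /compact_bounded[N [_ hN]].
pose c : R := Num.sqrt n%:R * (`|N| + 1).
have bd x : X x -> enorm x <= c.
  move=> Xx; apply: le_trans (enorm_le_norm x) _.
  rewrite ler_wpM2l ?sqrtr_ge0//; apply: hN => //.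
  by rewrite ltr_pwDr ?ler_norm.
have c0 : 0 <= c by rewrite mulr_ge0 ?sqrtr_ge0 ?addr_ge0.
exists (c + c + 1) => [|x y Xx Xy]; first by rewrite ltr_wpDl ?addr_ge0.
apply: le_trans (ler_enormD _ _) _; rewrite enormN.
by rewrite ler_wpDr// lerD ?bd.
Qed.

#[global] Opaque dot enorm.

(** * Local Newton estimates *)

Section RealAux.
Context {R : realType}.
Implicit Types (a b c p t : R).

Lemma ge0_linear_term a b :
  (forall t, 0 < t <= 1 -> 0 <= t * a + t ^+ 2 * b) -> 0 <= a.
Proof.
move=> h; rewrite leNgt; apply/negP => a0.
have c0 : 0 < - a + `|b| by rewrite ltr_wpDr ?oppr_gt0.
pose t := - a / (- a + `|b|) / 2.
have t0 : 0 < t by rewrite !divr_gt0 ?oppr_gt0.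
have E : t * (- a + `|b|) * 2 = - a by rewrite /t; field; rewrite gt_eqF.
have t1 : t <= 1.
  rewrite /t ler_pdivrMr// ler_pdivrMr// mul1r.
  by have := normr_ge0 b; lra.
have := h t; rewrite t0 t1 => /(_ isT).
rewrite expr2 -mulrA -mulrDr pmulr_rge0// => h1.
have : t * b <= t * `|b| by rewrite ler_wpM2l ?(ltW t0)// ler_norm.
have : 0 < t * - a by rewrite mulr_gt0// oppr_gt0.
by move: E h1; rewrite mulrDr; lra.
Qed.

Lemma quadratic_bound mu G b p : 0 < mu -> 0 <= G -> 0 <= b ->
  mu * p ^+ 2 <= G + b * p -> p <= b / mu + Num.sqrt (G / mu).
Proof.
move=> mu0 G0 b0 h; rewrite leNgt; apply/negP; set s := Num.sqrt _ => hp.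
have s0 : 0 <= s := sqrtr_ge0 _.
have bm0 : 0 <= b / mu by rewrite divr_ge0 ?(ltW mu0).
have sG : mu * s ^+ 2 = G.
  by rewrite sqr_sqrtr ?divr_ge0 ?(ltW mu0)// mulrC mulfVK ?gt_eqF.
have h1 : s * s < p * (p - b / mu).
  by apply: ltr_pM => //; lra.
have : mu * (s * s) < mu * (p * (p - b / mu)) by rewrite ltr_pM2l.
have -> : mu * (p * (p - b / mu)) = mu * p ^+ 2 - b * p.
  by field; rewrite gt_eqF.
by rewrite -expr2 sG; lra.
Qed.

End RealAux.

Section Gap.
Context {R : realType} {n : nat}.
Implicit Types (u v x G : 'rV[R]_n) (X : set 'rV[R]_n).

Lemma fw_gap_ub X G u v : compact X -> X u -> X v -> dot G (u - v) <= fw_gap X G u.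
Proof.
move=> cX Xu Xv; apply: sup_upper_bound; last by exists v.
split; first by exists (dot G (u - v)); exists v.
have [D D0 hD] := compact_enorm_bounded cX.
exists (enorm G * D) => _ [w Xw <-]; apply: le_trans (dot_le _ _) _.
by rewrite ler_wpM2l ?enorm_ge0 ?hD.
Qed.

Lemma fw_gap_le X G u (c : R) : X !=set0 ->
  (forall v, X v -> dot G (u - v) <= c) -> fw_gap X G u <= c.
Proof.
move=> [v Xv] h; apply: ge_sup => [|_ [w Xw <-]]; last exact: h.
by exists (dot G (u - v)); exists v.
Qed.

Lemma fw_gap_ge0 X G u : compact X -> X u -> 0 <= fw_gap X G u.
Proof. by move=> cX Xu; have := fw_gap_ub G cX Xu Xu; rewrite subrr dot0r. Qed.

(* The model [Psi1 f x] up to the constant [f x], with [h] and [H] for the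
   gradient and the Hessian at [x]. *)
Definition quad_model (h : 'rV[R]_n) (H : 'M[R]_n) x u : R :=
  dot h (u - x) + dot ((u - x) *m H) (u - x) / 2.

Lemma quad_model_step h H x u v (g : R) : H^T = H ->
  quad_model h H x (u + g *: v) = quad_model h H x u
    + g * dot (h + (u - x) *m H) v + g ^+ 2 * (dot (v *m H) v / 2).
Proof.
move=> sH; rewrite /quad_model addrAC.
move: (u - x) => d; rewrite dot_mulmxDl dotDr dotZr !dotDr !dotZr.
rewrite dot_mulmxZl dot_mulmxZl dotDl (dot_sym v d sH).
move: (dot h d) (dot h v) (dot (d *m H) d) (dot (d *m H) v) (dot (v *m H) v).
by move=> a b c e k; field.
Qed.

Lemma quad_model_continuous h H x : continuous (quad_model h H x).
Proof.
move=> u; have cB : continuous (fun u : 'rV[R]_n => u - x).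
  by move=> w; apply: (@continuousB _ _ _ id (cst x));
    [exact: cvg_id|exact: cst_continuous].
have c1 : continuous (fun w : 'rV[R]_n => dot h (w - x)).
  apply: (@continuous_dot R n _ (fun=> h)) => //; exact: cst_continuous.
have c2 : continuous (fun w : 'rV[R]_n => dot ((w - x) *m H) (w - x)).
  apply: (@continuous_quad R n _ _ (fun=> H)) => //; exact: cst_continuous.
exact: (cvgD (c1 u) (cvgM (c2 u) (cvg_cst _))).
Qed.

Lemma quad_model_argmin X h H x : X !=set0 -> compact X -> convex_set X ->
  H^T = H -> exists u, [/\ X u, forall v, X v -> quad_model h H x u <= quad_model h H x v
    & forall v, X v -> dot (h + (u - x) *m H) (u - v) <= 0].
Proof.
move=> X0 cX cvX sH.
have := EVT_min_rV X0 cX (continuous_subspaceT (@quad_model_continuous h H x)).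
move=> [u]; rewrite inE => Xu umin.
have um v : X v -> quad_model h H x u <= quad_model h H x v.
  by move=> Xv; apply: umin; rewrite inE.
exists u; split=> // v Xv; rewrite -(opprB v u) dotNr oppr_le0.
apply: (@ge0_linear_term R _ (dot ((v - u) *m H) (v - u) / 2)) => t /andP[t0 t1].
have /um : X (u + t *: (v - u)) by apply: convex_segment => //; rewrite t1 ltW.
by rewrite quad_model_step// -addrA lerDl.
Qed.

End Gap.

Section LocalNewton.
Context {R : realType} {n : nat}.
Variables (X : set 'rV[R]_n) (f : 'rV[R]_n -> R) (mu L M D : R) (xs : 'rV[R]_n).
Hypotheses (cX : compact X) (cvX : convex_set X) (tdf : twice_differentiable f).
Hypotheses (mu0 : 0 < mu) (L0 : 0 < L) (M0 : 0 < M) (hb : hess_bounds X f mu L M).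
Hypotheses (Xxs : X xs) (xs_min : forall y, X y -> f xs <= f y).

Lemma gap_ge_dist x : X x -> mu * enorm (x - xs) ^+ 2 <= fw_gap X (grad f x) x.
Proof.
move=> Xx; apply: le_trans (fw_gap_ub (grad f x) cX Xx Xxs).
apply: le_trans (grad_strongly_monotone cvX tdf hb Xxs Xx) _.
rewrite dotBl lerBlDr lerDl.
exact: (minimizer_stationary cvX tdf mu0 hb Xxs xs_min).
Qed.

Lemma quadratic_growth x : X x -> mu / 4 * enorm (x - xs) ^+ 2 <= f x - f xs.
Proof.
move=> Xx; pose m := xs + 2^-1 *: (x - xs).
have h01 : 0 <= (2^-1 : R) <= 1 by lra.
have Xm : X m by exact: convex_segment.
have e1 : m - xs = 2^-1 *: (x - xs) by rewrite /m addrAC subrr add0r.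
have e2 : x - m = 2^-1 *: (x - xs).
  have -> : x - m = (x - xs) - 2^-1 *: (x - xs) by rewrite /m opprD addrA.
  rewrite -{1}(scale1r (x - xs)) -scalerBl; congr (_ *: _); lra.
have h1 := gradient_inequality cvX tdf mu0 hb Xm Xx.
have h2 := grad_strongly_monotone cvX tdf hb Xxs Xm.
have h3 := minimizer_stationary cvX tdf mu0 hb Xxs xs_min Xm.
have h4 := xs_min Xm.
move: h1 h2 h3; rewrite dotBl e1 e2 enormZ exprMn real_normK ?num_real//.
move: h4; generalize (dot (grad f m) (2^-1 *: (x - xs))).
generalize (dot (grad f xs) (2^-1 *: (x - xs))) => a b.
by move: (f x) (f xs) (f m) (enorm (x - xs)) a b => *; lra.
Qed.

Lemma minimizer_unique x : X x -> fw_gap X (grad f x) x = 0 -> x = xs.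
Proof.
move=> Xx g0; have := gap_ge_dist Xx; rewrite g0 pmulr_rle0// => h.
apply/eqP; rewrite -subr_eq0 -enorm_eq0 -sqrf_eq0.
by rewrite eq_le h sqr_ge0.
Qed.

Section Step.
Variable x : 'rV[R]_n.
Hypothesis Xx : X x.
Let h := grad f x.
Let H := hess f x.
Let d := enorm (x - xs).

Lemma hess_sym : H^T = H.
Proof. exact: loewner_sym (hb.1 x Xx).1. Qed.

Lemma inexact_newton_dist u G : X u ->
  (forall v, X v -> dot (h + (u - x) *m H) (u - v) <= G) ->
  mu * enorm (u - xs) ^+ 2 <= G + M / 2 * d ^+ 2 * enorm (u - xs).
Proof.
have aux (a b c k T e : R) :
  a + (b + c) <= G -> 0 <= k -> k - a - c <= T -> e <= b -> e <= G + T by lra.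
move=> Xu /(_ xs Xxs).
have -> : u - x = (u - xs) + (xs - x) by rewrite addrA subrK.
rewrite dotDl dot_mulmxDl => h1.
have h2 := minimizer_stationary cvX tdf mu0 hb Xxs xs_min Xu.
have h3 := grad_taylor cvX tdf hb (u - xs) Xx Xxs.
have h4 := loewner_lower (u - xs) (hb.1 x Xx).1.
rewrite -(enormB x) !dotBl in h3.
exact: aux h1 h2 h3 h4.
Qed.

Lemma newton_point_dist u : X u ->
  (forall v, X v -> dot (h + (u - x) *m H) (u - v) <= 0) ->
  enorm (u - xs) <= M / (2 * mu) * d ^+ 2.
Proof.
move=> Xu /(inexact_newton_dist Xu).
have b0 : 0 <= M / 2 * d ^+ 2 by rewrite mulr_ge0 ?sqr_ge0// divr_ge0 ?(ltW M0).
move=> /(quadratic_bound mu0 (lexx 0) b0).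
rewrite mul0r sqrtr0 addr0; congr (_ <= _); field.
by rewrite gt_eqF.
Qed.

Hypothesis dD : Num.sqrt mu * d <= D.
Let c : R := 1 + M * D / (2 * mu `^ (3 / 2)).

Lemma powR32 : mu `^ (3 / 2) = mu * Num.sqrt mu.
Proof.
have -> : 3 / 2 = 1 + 2^-1 :> R by lra.
rewrite powRD; last by rewrite (gt_eqF mu0) implybT.
by rewrite powRr1 ?(ltW mu0)// powR12_sqrt ?(ltW mu0).
Qed.

Lemma distD_ge0 : 0 <= D.
Proof. by apply: le_trans dD; rewrite mulr_ge0 ?sqrtr_ge0 ?enorm_ge0. Qed.

Lemma newton_factor_ge : 1 + M / (2 * mu) * d <= c.
Proof.
have s0 : 0 < Num.sqrt mu by rewrite sqrtr_gt0.
rewrite /c lerD2l powR32.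
have -> : M * D / (2 * (mu * Num.sqrt mu)) = M / (2 * mu) * (D / Num.sqrt mu).
  by field; rewrite !gt_eqF.
rewrite ler_wpM2l ?divr_ge0 ?(ltW M0) ?mulr_ge0 ?(ltW mu0)//.
by rewrite ler_pdivlMr// mulrC.
Qed.

Lemma model_decrease_le u : X u -> - quad_model h H x u <= enorm h * (c * d).
Proof.
move=> Xu.
have [|u1 [Xu1 u1min u1st]] := quad_model_argmin h x _ cX cvX hess_sym.
  by exists x.
have := u1min _ Xu; rewrite -lerN2 => /le_trans; apply.
have q0 : 0 <= dot ((u1 - x) *m H) (u1 - x).
  exact: loewner_psd mu0 (hb.1 x Xx).1.
apply: (@le_trans _ _ (dot h (x - u1))).
  rewrite /quad_model -(opprB u1 x) dotNr opprD lerBlDr lerDl.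
  by rewrite divr_ge0.
apply: le_trans (dot_le _ _) _; rewrite ler_wpM2l ?enorm_ge0//.
have -> : x - u1 = (x - xs) + (xs - u1) by rewrite addrA subrK.
apply: le_trans (ler_enormD _ _) _; rewrite (enormB xs).
have := newton_point_dist Xu1 u1st.
have : (1 + M / (2 * mu) * d) * d <= c * d.
  by rewrite ler_wpM2r ?enorm_ge0 ?newton_factor_ge.
have -> : (1 + M / (2 * mu) * d) * d = d + M / (2 * mu) * d ^+ 2 by ring.
rewrite -/d; move: (M / (2 * mu) * d ^+ 2) (c * d) => p q h1 h2.
by apply: le_trans h1; rewrite lerD2l.
Qed.

Section Inexact.
Variables (u : 'rV[R]_n).
Hypotheses (Xu : X u) (dec : quad_model h H x u <= 0) (h0 : h != 0).
Let G := fw_gap X (h + (u - x) *m H) u.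
Hypothesis test : G <= (- quad_model h H x u / enorm h) ^+ 4.

Lemma newton_factor_ge0 : 0 <= c.
Proof.
by rewrite addr_ge0// divr_ge0 ?mulr_ge0 ?powR_ge0 ?(ltW M0) ?distD_ge0.
Qed.

Lemma gap_quartic : G <= (c * d) ^+ 4.
Proof.
apply: le_trans test _; rewrite lerXn2r ?nnegrE//.
- by rewrite divr_ge0 ?enorm_ge0// oppr_ge0.
- by rewrite mulr_ge0 ?newton_factor_ge0 ?enorm_ge0.
by rewrite ler_pdivrMr ?enorm_gt0// mulrC model_decrease_le.
Qed.

Lemma newton_step_dist : enorm (u - xs) <= C3 mu M D * d ^+ 2.
Proof.
have G0 : 0 <= G by exact: fw_gap_ge0.
have b0 : 0 <= M / 2 * d ^+ 2 by rewrite mulr_ge0 ?sqr_ge0// divr_ge0 ?(ltW M0).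
have := inexact_newton_dist Xu (fun v Xv => fw_gap_ub _ cX Xu Xv).
move=> /(quadratic_bound mu0 G0 b0) /le_trans; apply.
rewrite /C3 mulrDl lerD//.
  by rewrite le_eqVlt; apply/orP; left; apply/eqP; field; rewrite gt_eqF.
rewrite -/c -mulrA -exprMn.
have -> : (c * d) ^+ 2 = Num.sqrt ((c * d) ^+ 4).
  rewrite (_ : (c * d) ^+ 4 = ((c * d) ^+ 2) ^+ 2); last by ring.
  by rewrite sqrtr_sqr ger0_norm ?sqr_ge0.
rewrite -sqrtrM; last by rewrite divr_ge0 ?(ltW mu0).
rewrite ler_wsqrtr// mulrC ler_pM ?invr_ge0 ?(ltW mu0) ?gap_quartic//.
by rewrite ler_peMl ?invr_ge0 ?(ltW mu0)// ler1n.
Qed.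

Lemma newton_step_value :
  f u - f xs <= (c ^+ 4 + M / 2 * (C3 mu M D * d + 1) ^+ 2 * C3 mu M D) * d ^+ 4.
Proof.
have aux (a b k e T : R) : - e <= - k -> e - a - b <= T -> a + b <= G ->
    k <= G + T by lra.
have h1 := gradient_inequality cvX tdf mu0 hb Xu Xxs.
rewrite -(opprB u xs) dotNr -(opprB (f u)) in h1.
have h2 := grad_taylor cvX tdf hb (u - xs) Xx Xu.
have h3 := fw_gap_ub (h + (u - x) *m H) cX Xu Xxs.
rewrite dotDl in h3; rewrite !dotBl in h2.
apply: le_trans (aux _ _ _ _ _ h1 h2 h3) _.
rewrite mulrDl lerD//; first by rewrite -exprMn gap_quartic.
set C := C3 mu M D.
have C0 : 0 <= C * d ^+ 2.
  by apply: le_trans newton_step_dist; rewrite enorm_ge0.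
have hux : enorm (u - x) <= (C * d + 1) * d.
  have -> : u - x = (u - xs) + (xs - x) by rewrite addrA subrK.
  apply: le_trans (ler_enormD _ _) _; rewrite (enormB xs).
  by rewrite mulrDl mul1r lerD2r -mulrA -expr2 newton_step_dist.
have -> : M / 2 * (C * d + 1) ^+ 2 * C * d ^+ 4 =
  M / 2 * ((C * d + 1) * d) ^+ 2 * (C * d ^+ 2) by ring.
rewrite ler_pM ?mulr_ge0 ?sqr_ge0 ?enorm_ge0 ?invr_ge0 ?(ltW M0)//; last first.
  exact: newton_step_dist.
rewrite ler_wpM2l ?divr_ge0 ?(ltW M0)// lerXn2r ?nnegrE ?enorm_ge0//.
exact: le_trans (enorm_ge0 _) hux.
Qed.

End Inexact.
End Step.
End LocalNewton.

(** * Inner procedures *)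

Section InnerProcedure.
Context {R : realType} {n : nat}.
Implicit Types (u v w x h G : 'rV[R]_n) (H : 'M[R]_n) (X : set 'rV[R]_n).
Implicit Types (m : inner_proc) (y : @iterate R n) (g : R).

Lemma sum_indicator (s : seq 'rV[R]_n) v (g : R) : uniq s -> v \in s ->
  \sum_(w <- s) g * (w == v)%:R = g.
Proof.
move=> us vs; rewrite (bigD1_seq v)//= eqxx mulr1 big1 ?addr0// => w /negbTE ->.
by rewrite mulr0.
Qed.

Lemma sum_indicatorv (s : seq 'rV[R]_n) v (g : R) : uniq s -> v \in s ->
  \sum_(w <- s) (g * (w == v)%:R) *: w = g *: v.
Proof.
move=> us vs; rewrite (bigD1_seq v)//= eqxx mulr1 big1 ?addr0// => w /negbTE ->.
by rewrite mulr0 scale0r.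
Qed.

Lemma convex_sum X (s : seq 'rV[R]_n) (c : 'rV[R]_n -> R) : convex_set X ->
  {in s, forall v, X v} -> (forall v, 0 <= c v) -> \sum_(v <- s) c v = 1 ->
  X (\sum_(v <- s) c v *: v).
Proof.
move=> cX sX c0.
suff [[-> _] /eqP|[W0 WX] W1] : (\sum_(v <- s) c v = 0 /\ \sum_(v <- s) c v *: v = 0)
    \/ (0 < \sum_(v <- s) c v /\
        X ((\sum_(v <- s) c v)^-1 *: \sum_(v <- s) c v *: v)).
- by rewrite eq_sym oner_eq0.
- by move: WX; rewrite W1 invr1 scale1r.
elim: s sX => [|a s IH] sX; first by left; rewrite !big_nil.
have Xa : X a by apply: sX; rewrite mem_head.
have {}IH := IH (fun v vs => sX v (mem_behead (s := a :: s) vs)).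
rewrite !big_cons; have := c0 a; rewrite le_eqVlt => /predU1P[<-|ca0].
  by rewrite scale0r !add0r.
right; case: IH => [[-> ->]|[W0 XW]].
  by rewrite !addr0 scalerA mulVf ?gt_eqF// scale1r.
set W := \sum_(v <- s) c v in W0 XW *; set P := \sum_(v <- s) _ in XW *.
have cW : 0 < c a + W by rewrite addr_gt0.
split => //; pose t := c a / (c a + W).
have -> : (c a + W)^-1 *: (c a *: a + P) = t *: a + (1 - t) *: (W^-1 *: P).
  rewrite scalerDr !scalerA; congr (_ *: _ + _ *: _); rewrite /t.
    by rewrite mulrC.
  by field; rewrite !gt_eqF.
apply: convex_comb => //; rewrite divr_ge0 ?(ltW ca0) ?(ltW cW)//=.
by rewrite ler_pdivrMr// mul1r lerDl ltW.
Qed.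

(* [S] may be larger than [active y]: nothing is ever removed from it. *)
Definition convex_decomposition X y (S : {fset 'rV[R]_n}) :=
  [/\ {subset active y <= S}, {in S, forall v, X v}, forall v, 0 <= weight y v,
      \sum_(v <- S) weight y v = 1 & pt y = \sum_(v <- S) weight y v *: v]
  /\ forall v, v \notin S -> weight y v = 0.

Definition valid_iterate X m y :=
  X (pt y) /\ (m = AFW -> exists S, convex_decomposition X y S).

Lemma convex_decompositionU1 X y S v : convex_decomposition X y S -> X v ->
  convex_decomposition X y (v |` S)%fset.
Proof.
move=> [[aS SX w0 w1 ypt] wS] Xv.
have [vS|vS] := boolP (v \in S).
  by rewrite (fsetUidPr _ _ _) ?fsub1set//.
have perm : perm_eq (v |` S)%fset (v :: S).
  apply: uniq_perm => //=; first by rewrite fset_uniq vS.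
  by move=> a; rewrite in_fset1U in_cons.
split; [split => //|].
- by move=> a /aS aS'; rewrite in_fset1U aS' orbT.
- by move=> a; rewrite in_fset1U => /predU1P[->//|]; exact: SX.
- by rewrite (perm_big _ perm) big_cons /= wS// add0r.
- by rewrite (perm_big _ perm) big_cons /= wS// scale0r add0r.
- by move=> a; rewrite in_fset1U negb_or => /andP[_]; exact: wS.
Qed.

Lemma hnormN H u : hnorm H (- u) = hnorm H u.
Proof. by rewrite /hnorm mulNmx dotNl dotNr opprK. Qed.

Lemma line_search_decrease h H x u d g : H^T = H ->
  (forall z, 0 <= dot (z *m H) z) -> 0 <= g ->
  g <= dot (h + (u - x) *m H) d / hnorm H d ^+ 2 ->
  quad_model h H x (u - g *: d) <= quad_model h H x u.
Proof.
have aux (q a b : R) : 0 <= b -> 0 <= g -> g <= a / b ->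
    q + g * - a + g ^+ 2 * (b / 2) <= q.
  rewrite le_eqVlt => /predU1P[<-|b0] g0.
    rewrite invr0 mulr0 => g0'.
    have -> : g = 0 by apply/eqP; rewrite eq_le g0 g0'.
    by rewrite expr0n !mul0r !addr0.
  rewrite ler_pdivlMr// => gb.
  have := ler_wpM2l g0 gb; have := mulr_ge0 g0 (ltW b0).
  rewrite !mulrA -expr2 => h1 h2.
  have : 0 <= g * (g * b) by rewrite mulr_ge0.
  by rewrite mulrA -expr2; lra.
move=> sH psd g0; rewrite sqr_hnorm// => gle.
rewrite -scalerN quad_model_step// dotNr mulNmx dotNl dotNr opprK.
exact: aux.
Qed.

Lemma inner_step_spec X m h H x y v y' : convex_set X -> H^T = H ->
  (forall z, 0 <= dot (z *m H) z) -> valid_iterate X m y ->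
  lmo X m (h + (pt y - x) *m H) v ->
  inner_step m H (h + (pt y - x) *m H) y v y' ->
  valid_iterate X m y' /\ quad_model h H x (pt y') <= quad_model h H x (pt y).
Proof.
set G := _ + _ => cX sH psd [Xy dec] [[Xv vmin] _].
have a0 : 0 <= dot G (pt y - v) by rewrite dotBr subr_ge0 vmin.
have q0 d : 0 <= dot G d -> 0 <= dot G d / hnorm H d ^+ 2.
  by move=> ?; rewrite divr_ge0 ?sqr_ge0.
case: m dec => [_|/(_ erefl)[S dec]] /=.
  move=> ->; rewrite /fw_next; set g := Num.min _ _.
  have gE : g = Num.min 1 (dot G (pt y - v) / hnorm H (pt y - v) ^+ 2).
    by rewrite /g -(opprB (pt y)) hnormN.
  have g0 : 0 <= g by rewrite gE le_min ler01 q0.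
  have g1 : g <= 1 by rewrite gE ge_min lexx.
  have E : (1 - g) *: pt y + g *: v = pt y - g *: (pt y - v).
    by rewrite scalerBl scale1r scalerBr opprB -addrA [- _ + _]addrC.
  split; first split => //=.
    by rewrite addrC; have := convex_comb (t := g) cX Xv Xy; rewrite g0 g1; apply.
  rewrite /= E line_search_decrease//.
  by rewrite gE ge_min lexx orbT.
move=> [vA [vAa vAmax ->]].
case: ifP => [_|/negbT]; last rewrite -ltNge => away.
  rewrite /afw_fw_next; set g := Num.min _ _.
  have g0 : 0 <= g by rewrite le_min ler01 q0.
  have g1 : g <= 1 by rewrite ge_min lexx.
  have E : pt y - g *: (pt y - v) = (1 - g) *: pt y + g *: v.
    by rewrite scalerBl scale1r scalerBr opprB -addrA [- _ + _]addrC.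
  split; last by rewrite line_search_decrease// ge_min lexx orbT.
  split=> /=.
    by rewrite E addrC; have := convex_comb (t := g) cX Xv Xy; rewrite g0 g1; apply.
  move=> _; exists (v |` S)%fset.
  have [[aS SX w0 w1 ypt] wS] := convex_decompositionU1 dec Xv.
  have vS : v \in (v |` S)%fset by rewrite fset1U1.
  split; [split => //=|].
  - case: ifP => _ a; first by rewrite in_fset1 => /eqP ->.
    by rewrite in_fset1U => /predU1P[->//|]; exact: aS.
  - by move=> a; rewrite addr_ge0 ?mulr_ge0 ?subr_ge0.
  - by rewrite big_split /= -mulr_sumr w1 sum_indicator ?fset_uniq// mulr1 subrK.
  - under eq_bigr do rewrite scalerDl -scalerA.
    by rewrite big_split /= -scaler_sumr -ypt sum_indicatorv ?fset_uniq.
  - move=> a aS' /=; rewrite wS// mulr0 add0r (_ : (a == v) = false) ?mulr0//.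
    by apply: contraNF aS' => /eqP ->.
rewrite /afw_away_next; set g := Num.min _ _.
have [[aS SX w0 w1 ypt] wS] := dec.
have vAS := aS _ vAa.
set l := weight y vA in g *.
have l1 : l <= 1.
  rewrite -w1 (bigD1_seq vA) ?fset_uniq//= -/l.
  by rewrite lerDl; apply: sumr_ge0 => ? _; exact: w0.
have d0 : 0 <= dot G (vA - pt y) by apply: le_trans a0 (ltW away).
have g0 : 0 <= g by rewrite le_min q0// divr_ge0 ?subr_ge0// w0.
have gl : g * (1 - l) <= l.
  move: l1; rewrite le_eqVlt => /predU1P[->|l1]; first by rewrite subrr mulr0.
  by rewrite -ler_pdivlMr ?subr_gt0// /g ge_min lexx.
have yptE : pt y - g *: (vA - pt y) =
    \sum_(w <- S) ((1 + g) * weight y w - g * (w == vA)%:R) *: w.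
  under eq_bigr do rewrite scalerBl -scalerA.
  rewrite sumrB -scaler_sumr -ypt sum_indicatorv ?fset_uniq//.
  by rewrite scalerDl scale1r scalerBr opprB addrA [in RHS]addrAC addrAC.
have wt0 w : 0 <= (1 + g) * weight y w - g * (w == vA)%:R.
  have [->|_] := eqVneq w vA; last by rewrite mulr0 subr0 mulr_ge0 ?addr_ge0.
  by rewrite mulr1 -/l; move: gl; lra.
have wt1 : \sum_(w <- S) ((1 + g) * weight y w - g * (w == vA)%:R) = 1.
  rewrite sumrB -mulr_sumr w1 sum_indicator ?fset_uniq//.
  by rewrite mulr1 addrK.
split; last by rewrite line_search_decrease// ge_min lexx orbT.
split=> [|_]; first by rewrite /= yptE; apply: convex_sum.
exists S; split; [split => //=|].
- by case: ifP => _ a //; [rewrite in_fsetD1 => /andP[_]|]; exact: aS.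
- move=> a aS' /=; rewrite wS// mulr0 sub0r (_ : (a == vA) = false) ?mulr0 ?oppr0//.
  by apply: contraNF aS' => /eqP ->.
Qed.

Lemma inner_returns_spec X m h H (stop : 'rV[R]_n -> 'rV[R]_n -> Prop) y0 y1 :
  convex_set X -> H^T = H -> (forall z, 0 <= dot (z *m H) z) ->
  valid_iterate X m y0 -> inner_returns X m h H stop y0 y1 ->
  [/\ valid_iterate X m y1, quad_model h H (pt y0) (pt y1) <= 0 &
    exists2 v, argmin_lin X (h + (pt y1 - pt y0) *m H) v & stop (pt y1) v].
Proof.
move=> cX sH psd val [T [y [v [y00 yT lm st stp]]]].
have all t : (t <= T)%N ->
    valid_iterate X m (y t) /\ quad_model h H (pt y0) (pt (y t)) <= 0.
  elim: t => [_|t IH tT].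
    by rewrite y00; split=> //; rewrite /quad_model subrr dot0r mul0mx dot0l mul0r addr0.
  have [vt qt] := IH (ltnW tT).
  have lmt := lm t (ltnW tT); have [_ stt] := st t tT.
  have [v' q'] := inner_step_spec cX sH psd vt lmt stt.
  by split=> //; exact: le_trans q' qt.
have [vT qT] := all T (leqnn T).
split; rewrite -?yT//; exists (v T); last by [].
exact: (lm T (leqnn T)).1.
Qed.

Lemma start_valid X m theta0 (s : @mstate R n) :
  start X m theta0 s -> valid_iterate X m (cur s).
Proof.
case=> Xp afw _ _ _; split=> // /afw[_ act wt].
exists [fset pt (cur s)]%fset; split; [split|].
- by rewrite act.
- by move=> v; rewrite in_fset1 => /eqP ->.
- by move=> v; rewrite wt.
- by rewrite big_seq_fset1 wt eqxx.
- by rewrite big_seq_fset1 wt eqxx scale1r.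
- by move=> v; rewrite in_fset1 wt => /negbTE ->.
Qed.

End InnerProcedure.

(** * Damped phase *)

Section Potential.
Context {R : realType}.
Variables (p sigma B c rho omega : R).
Hypotheses (p0 : 0 <= p) (sigma0 : 0 <= sigma) (ps : p + sigma = 2)
  (B0 : 0 < B) (c0 : 0 < c)
  (rho0 : 0 < rho) (rho1 : rho < 1)
  (omega0 : 0 < omega) (omega1 : omega < c * rho ^+ 2 * (1 - rho `^ p)).

Let A := c * rho ^+ 2 / B.
Let delta := (c * rho ^+ 2 * (1 - rho `^ p) - omega) / B.

Lemma potential_rate_gt0 : 0 < delta.
Proof. by rewrite divr_gt0// subr_gt0. Qed.

Lemma powR_split (D : R) : 0 < D -> D `^ p * D `^ sigma = D ^+ 2.
Proof.
move=> D0; rewrite -powRD; last by rewrite (gt_eqF D0) implybT.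
by rewrite ps powR_mulrn// ltW.
Qed.

(* The bound on [omega] is what makes the weight [A] of [Delta ^ p] both large
   enough for the steps with [Delta_{k+1} = rho * Delta_k] and small enough for
   those where [Delta_{k+1}] is the new residual [r]. *)
Lemma potential_decrease (F0 F1 D0 r : R) : 0 < D0 -> 0 <= r ->
  c / (B * D0 `^ sigma) * r ^+ 2 - omega * D0 ^+ 2 / (1 + B * D0 `^ sigma)
    <= F0 - F1 ->
  delta * D0 `^ p <= (F0 + A * D0 `^ p) - (F1 + A * Num.max r (rho * D0) `^ p).
Proof.
move=> D00 r0; have := powR_split D00.
set S := D0 `^ sigma; set P := D0 `^ p => PS.
have S0 : 0 < S by rewrite powR_gt0.
have P0 : 0 < P by rewrite powR_gt0.
have BS : 0 < B * S by rewrite mulr_gt0.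
have etaP : omega * D0 ^+ 2 / (1 + B * S) <= omega * P / B.
  rewrite -PS ler_pdivrMr; last by rewrite addr_gt0.
  have -> : omega * P / B * (1 + B * S) = omega * P / B + omega * (P * S).
    by field; rewrite gt_eqF.
  by rewrite lerDr divr_ge0 ?(ltW B0)// mulr_ge0 ?ltW.
have rp0 : 0 < rho `^ p by rewrite powR_gt0.
have cr0 : 0 < c * rho ^+ 2 by rewrite mulr_gt0 ?exprn_gt0.
have AB : A = c * rho ^+ 2 / B by [].
have A0 : 0 < A by rewrite divr_gt0.
have rho21 : rho ^+ 2 <= 1 by rewrite expr_le1 ?ltW.
have crc : c * rho ^+ 2 <= c by rewrite ler_piMr ?(ltW c0).
have crp : 0 <= c * rho ^+ 2 * rho `^ p by rewrite mulr_ge0 ?ltW.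
have PB0 : 0 < P / B by rewrite divr_gt0.
have dE : delta * P = (c * rho ^+ 2 - c * rho ^+ 2 * rho `^ p - omega) * (P / B).
  by rewrite /delta; field; rewrite gt_eqF.
have [rle|rgt] := leP r (rho * D0).
  rewrite (powRM _ (ltW rho0) (ltW D00)) -/P => hF.
  have : 0 <= c / (B * S) * r ^+ 2 by rewrite mulr_ge0 ?sqr_ge0// divr_ge0 ?ltW.
  rewrite dE.
  have -> : (c * rho ^+ 2 - c * rho ^+ 2 * rho `^ p - omega) * (P / B) =
     A * P - A * (rho `^ p * P) - omega * P / B by rewrite AB; field; rewrite gt_eqF.
  by move: hF etaP; lra.
have r1 : 0 < r by apply: le_lt_trans rgt; rewrite mulr_ge0 ?ltW.
have [rD|rD] := leP r D0.
  have : r `^ p <= P by apply: ge0_ler_powR => //; rewrite nnegrE ltW.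
  move=> /(ler_wpM2l (ltW A0)) h1 hF.
  have h2 : c * rho ^+ 2 * (P / B) <= c / (B * S) * r ^+ 2.
    have -> : c * rho ^+ 2 * (P / B) = c / (B * S) * (rho * D0) ^+ 2.
      by rewrite exprMn -PS; field; rewrite !gt_eqF.
    rewrite ler_wpM2l ?divr_ge0 ?(ltW c0) ?(ltW BS)//.
    by rewrite lerXn2r ?nnegrE ?mulr_ge0 ?ltW.
  have h3 : 0 <= c * rho ^+ 2 * rho `^ p * (P / B) by rewrite mulr_ge0 ?(ltW PB0).
  rewrite dE; move: hF etaP h1 h2 h3; rewrite -mulrA; lra.
have rS : S <= r `^ sigma.
  by apply: ge0_ler_powR => //; rewrite ?nnegrE ltW.
have h1 : A * r `^ p <= c * rho ^+ 2 / (B * S) * r ^+ 2.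
  rewrite -(powR_split r1) AB.
  have -> : c * rho ^+ 2 / (B * S) * (r `^ p * r `^ sigma) =
     c * rho ^+ 2 / B * r `^ p * (r `^ sigma / S) by field; rewrite !gt_eqF.
  rewrite ler_peMr//; first by rewrite mulr_ge0 ?powR_ge0 ?(ltW A0)//.
  by rewrite ler_pdivlMr// mul1r.
have h2 : (c - c * rho ^+ 2) * (P / B) <= (c - c * rho ^+ 2) / (B * S) * r ^+ 2.
  have -> : (c - c * rho ^+ 2) * (P / B) = (c - c * rho ^+ 2) / (B * S) * D0 ^+ 2.
    by rewrite -PS; field; rewrite !gt_eqF.
  rewrite ler_wpM2l ?divr_ge0 ?subr_ge0 ?(ltW BS)//.
  by rewrite lerXn2r ?nnegrE ?(ltW D00) ?(ltW r1) ?(ltW rD).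
have h3 : 0 <= c * rho ^+ 2 * rho `^ p * (P / B) by rewrite mulr_ge0 ?(ltW PB0).
have h4 : 0 <= (c - c * rho ^+ 2) * (P / B).
  by rewrite mulr_ge0 ?subr_ge0 ?(ltW PB0).
have h5 : A * P = c * rho ^+ 2 * (P / B) by rewrite AB; field; rewrite gt_eqF.
have h6 : c / (B * S) * r ^+ 2 = (c - c * rho ^+ 2) / (B * S) * r ^+ 2 +
  c * rho ^+ 2 / (B * S) * r ^+ 2 by field; rewrite !gt_eqF.
rewrite dE h6 h5 => hF.
move: hF etaP h1 h2 h3 h4; rewrite -(mulrA omega); lra.
Qed.

Lemma residuals_get_small (F D r : nat -> R) (Fmin e : R) : 0 < e ->
  (forall k, Fmin <= F k) -> (forall k, 0 < D k) -> (forall k, 0 <= r k) ->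
  (forall k, D k.+1 = Num.max (r k) (rho * D k)) ->
  (forall k, c / (B * D k `^ sigma) * r k ^+ 2
     - omega * D k ^+ 2 / (1 + B * D k `^ sigma) <= F k - F k.+1) ->
  exists k, D k.+1 < e.
Proof.
move=> e0 Fm D0 r0 DS hF; apply: contrapT => /forallNP small.
have De k : e <= D k.+1 by rewrite leNgt; apply/negP/small.
pose E k := F k + A * D k `^ p.
have A0 : 0 <= A by rewrite divr_ge0 ?(ltW B0)// mulr_ge0 ?sqr_ge0 ?ltW.
have step k : E k.+2 <= E k.+1 - delta * e `^ p.
  have := potential_decrease (D0 k.+1) (r0 k.+1) (hF k.+1).
  rewrite -DS -/(E _) -/(E k.+2).
  have : delta * e `^ p <= delta * D k.+1 `^ p.
    rewrite ler_wpM2l ?(ltW potential_rate_gt0)//.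
    by apply: ge0_ler_powR; rewrite ?nnegrE ?(ltW e0) ?(ltW (D0 _)).
  lra.
have d0 : 0 < delta * e `^ p by rewrite mulr_gt0 ?powR_gt0 ?potential_rate_gt0.
have Ek k : E k.+1 <= E 1%N - k%:R * (delta * e `^ p).
  elim: k => [|k IH]; first by rewrite mul0r subr0.
  by have := step k; rewrite -natr1 mulrDl mul1r; lra.
have Em k : Fmin <= E k by rewrite (le_trans (Fm k))// lerDl mulr_ge0 ?powR_ge0.
pose N := Num.truncn ((E 1%N - Fmin) / (delta * e `^ p)).
have : (E 1%N - Fmin) / (delta * e `^ p) < N.+1%:R by exact: truncnS_gt.
rewrite ltr_pdivrMr//; have := Ek N.+1; have := Em N.+2; lra.
Qed.

End Potential.

Section DampedPhase.
Context {R : realType} {n : nat}.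
Variables (X : set 'rV[R]_n) (f : 'rV[R]_n -> R) (m : inner_proc).
Variables (mu L M q L3 c3 rho omega tau : R) (xs : 'rV[R]_n).
Hypotheses (cX : compact X) (cvX : convex_set X) (tdf : twice_differentiable f).
Hypotheses (mu0 : 0 < mu) (L0 : 0 < L) (M0 : 0 < M) (hb : hess_bounds X f mu L M).
Hypotheses (Xxs : X xs) (xs_min : forall y, X y -> f xs <= f y).
Hypotheses (q2 : 2 < q) (L30 : 0 < L3) (c30 : 0 < c3) (rho0 : 0 < rho) (rho1 : rho < 1).
Hypotheses (omega0 : 0 < omega) (tau1 : 1 < tau).

Let B := Bq q L3 omega rho.
Let sigma := (q - 2) / (q - 1).

Lemma Bq_gt0 : 0 < B.
Proof.
have k0 : 0 < kappa omega rho by rewrite divr_gt0// ltr_wpDr ?sqrtr_ge0.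
by rewrite mulr_gt0 ?powR_gt0 ?mulr_gt0.
Qed.

Let eta (D : R) := omega * D ^+ 2 / (1 + B * D `^ sigma).

Lemma damped_step_spec s s' : valid_iterate X m (cur s) -> 0 < thetabar s ->
  damped_step X f m q L3 c3 rho omega tau s s' -> 0 < Dprev s' ->
  let x := pt (cur s) in let x' := pt (cur s') in
  let D := Dprev s' in let r := grad f x' + sprev s' in
  [/\ valid_iterate X m (cur s'), 0 < thetabar s',
    forall v, X v -> dot (- sprev s') (x' - v) <= eta D &
    c3 / (B * D `^ sigma) * dual_lnorm f x r ^+ 2 - eta D <= f x - f x'].
Proof.
move=> val th0 [J [y [inner _ acc ->]]] /=.
set x := pt (cur s) in inner acc *.
set h := grad f x in inner acc *.
set D := Num.max _ _ in inner acc *.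
set beta := Bq q L3 omega rho * D `^ sigma in inner acc *.
move=> D0; have beta0 : 0 < beta by rewrite mulr_gt0 ?Bq_gt0 ?powR_gt0.
set theta := Num.min (tau ^+ J * thetabar s) beta in acc *.
have theta0 : 0 < theta.
  by rewrite lt_min beta0 mulr_gt0 ?exprn_gt0// (lt_trans ltr01).
have theta_le : theta <= beta by rewrite ge_min lexx orbT.
have a0 : 0 < 1 + theta by rewrite addr_gt0.
have Xx : X x := val.1.
have [muH HL] := hb.1 x Xx.
have sH : (((1 + theta)^-1)^-1 *: hess f x)^T = ((1 + theta)^-1)^-1 *: hess f x.
  by rewrite linearZ /= (loewner_sym muH).
have psd z : 0 <= dot (z *m (((1 + theta)^-1)^-1 *: hess f x)) z.
  by rewrite dot_mulmxZr mulr_ge0 ?invrK ?(ltW a0)// (loewner_psd z mu0 muH).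
have [valJ _ [v0 [Xv0 v0min] gt]] :=
  inner_returns_spec cvX sH psd val (inner J (leqnn J)).
rewrite /gap_test -/x in gt v0min; move: acc gt v0min.
set x' := pt (y J); set H := _ *: hess f x => acc gt v0min.
have Xx' : X x' := valJ.1.
set r := grad f x' + _ in acc *.
have gap v : X v -> dot (h + (x' - x) *m H) (x' - v) <= eta D.
  move=> Xv; apply: le_trans gt; rewrite !dotBr lerD2l lerN2.
  exact: v0min.
split=> //.
- by rewrite divr_gt0// (lt_trans ltr01).
- by move=> v Xv; rewrite opprD opprK; have := gap v Xv; rewrite opprK.
have hw : dot r ((h + (- h - (x' - x) *m H)) *m invmx (hess f x)) =
    (1 + theta) * dot r (x - x').
  rewrite addrA subrr add0r mulNmx -mulmxA /H invrK -scalemxAl.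
  by rewrite mulmxV ?(loewner_unitmx mu0 muH)// -scalemxAr mulmx1 -scalerN opprB dotZr.
rewrite hw in acc.
have hr : c3 / theta * dual_lnorm f x r ^+ 2 <= dot r (x - x').
  rewrite -(ler_pM2l a0); apply: le_trans acc.
  rewrite le_eqVlt; apply/orP; left; apply/eqP.
  by field; rewrite !gt_eqF.
have hr' : c3 / beta * dual_lnorm f x r ^+ 2 <= dot r (x - x').
  apply: le_trans hr; rewrite ler_wpM2r ?sqr_ge0// ler_wpM2l ?(ltW c30)//.
  by rewrite lef_pV2 ?posrE.
have hf := gradient_inequality cvX tdf mu0 hb Xx' Xx.
have hg := gap x Xx.
apply: le_trans hf.
have -> : grad f x' = r + (h + (x' - x) *m H) by rewrite /r -opprD subrK.
rewrite dotDl lerD//.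
by rewrite -(opprB x' x) dotNr lerN2.
Qed.

Lemma damped_step_valid s s' : valid_iterate X m (cur s) -> 0 <= thetabar s ->
  damped_step X f m q L3 c3 rho omega tau s s' ->
  valid_iterate X m (cur s') /\ 0 <= thetabar s'.
Proof.
move=> val th0 [J [y [inner _ _ ->]]] /=.
set D := Num.max _ _ in inner *.
set theta := Num.min (tau ^+ J * thetabar s) _.
have tau0 : 0 < tau := lt_trans ltr01 tau1.
have theta0 : 0 <= theta.
  by rewrite le_min !mulr_ge0 ?exprn_ge0 ?powR_ge0 ?(ltW tau0) ?(ltW Bq_gt0).
split; last by rewrite divr_ge0 ?(ltW tau0).
have muH := (hb.1 _ val.1).1.
set H := ((1 + theta)^-1)^-1 *: hess f (pt (cur s)).
have sH : H^T = H by rewrite linearZ /= (loewner_sym muH).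
have psd z : 0 <= dot (z *m H) z.
  by rewrite dot_mulmxZr mulr_ge0 ?invrK ?addr_ge0// (loewner_psd z mu0 muH).
by have [] := inner_returns_spec cvX sH psd val (inner J (leqnn J)).
Qed.

Lemma damped_step_Dprev s s' :
  damped_step X f m q L3 c3 rho omega tau s s' ->
  Dprev s' = Num.max (dual_lnorm f (pt (cur s)) (grad f (pt (cur s)) + sprev s))
               (rho * Dprev s).
Proof. by move=> [J [y [_ _ _ ->]]]. Qed.

Hypothesis omega1 :
  omega < c3 * mu / L * rho ^+ 2 * (1 - rho `^ (q / (q - 1))).

Lemma damped_gap_small (s : nat -> @mstate R n) (theta0 eps : R) :
  0 < eps -> 0 < theta0 -> start X m theta0 (s 0%N) ->
  (forall k, damped_step X f m q L3 c3 rho omega tau (s k) (s k.+1)) ->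
  exists k, fw_gap X (grad f (pt (cur (s k)))) (pt (cur (s k))) <= eps.
Proof.
move=> eps0 theta00 st steps.
have X0 : X !=set0 by exists xs.
have val0 := start_valid st.
case: st => Xx0 _ sprev0 Dprev0 tb0.
pose D k := Dprev (s k.+1); pose x k := pt (cur (s k)).
pose res k := grad f (x k.+1) + sprev (s k.+1).
pose r k := dual_lnorm f (x k.+1) (res k).
have DS k : D k.+1 = Num.max (r k) (rho * D k) by exact: damped_step_Dprev.
have D00 : 0 <= D 0%N.
  by rewrite /D (damped_step_Dprev (steps 0%N)) le_max sqrtr_ge0.
have [D00'|D0pos] := eqVneq (D 0%N) 0.
  exists 0%N; apply: fw_gap_le => // v Xv.
  have /eqP : D 0%N = 0 := D00'.
  rewrite /D (damped_step_Dprev (steps 0%N)) sprev0 Dprev0 addr0 mulr0.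
  rewrite max_l ?sqrtr_ge0// => /eqP r00.
  have := dual_hnorm_lower mu0 (hb.1 _ Xx0).1 L0 (hb.1 _ Xx0).2 (grad f (x 0%N)).
  rewrite /dual_lnorm in r00; rewrite r00 expr0n mulr0.
  rewrite -/(x 0%N) => g0.
  have -> : grad f (x 0%N) = 0.
    by apply/eqP; rewrite -enorm_eq0 -sqrf_eq0 eq_le g0 sqr_ge0.
  by rewrite dot0l ltW.
have Dpos k : 0 < D k.
  elim: k => [|k IH]; first by rewrite lt_neqAle eq_sym D0pos.
  by rewrite DS lt_max mulr_gt0 ?orbT.
have all k : valid_iterate X m (cur (s k)) /\ 0 < thetabar (s k).
  elim: k => [|k [vk tk]]; first by rewrite tb0.
  by have [] := damped_step_spec vk tk (steps k) (Dpos k).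
have Xx k : X (x k) := (all k).1.1.
have spec k := damped_step_spec (all k).1 (all k).2 (steps k) (Dpos k).
have q1 : 0 < q - 1 by move: q2; lra.
pose p := q / (q - 1).
have p0 : 0 <= p by rewrite divr_ge0 ?(ltW q1)//; move: q2; lra.
have sigma0 : 0 <= sigma by rewrite divr_ge0 ?(ltW q1)//; move: q2; lra.
have psig : p + sigma = 2 by rewrite /p /sigma; field; rewrite gt_eqF.
pose c := c3 * mu / L.
have c0 : 0 < c by rewrite divr_gt0 ?mulr_gt0.
have hF k : c / (B * D k `^ sigma) * r k ^+ 2
     - omega * D k ^+ 2 / (1 + B * D k `^ sigma) <= f (x k) - f (x k.+1).
  have [_ _ _] := spec k; apply: le_trans; rewrite lerD2r.
  have h1 := dual_hnorm_lower mu0 (hb.1 _ (Xx k)).1 L0 (hb.1 _ (Xx k)).2 (res k).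
  have h2 := dual_hnorm_upper mu0 (hb.1 _ (Xx k.+1)).1 (res k).
  have h3 := le_trans h2 h1.
  have BD : 0 < B * D k `^ sigma by rewrite mulr_gt0 ?Bq_gt0 ?powR_gt0.
  have -> : c / (B * D k `^ sigma) * r k ^+ 2 =
      c3 / (B * D k `^ sigma) / L * (mu * r k ^+ 2).
    by rewrite /c; field; rewrite !gt_eqF ?powR_gt0 ?Bq_gt0.
  have -> : c3 / (B * D k `^ sigma) * dual_lnorm f (x k) (res k) ^+ 2 =
      c3 / (B * D k `^ sigma) / L * (L * dual_lnorm f (x k) (res k) ^+ 2).
    by field; rewrite !gt_eqF ?powR_gt0 ?Bq_gt0.
  by rewrite ler_wpM2l// !divr_ge0 ?(ltW BD) ?(ltW c30) ?(ltW L0).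
have [Dm Dm0 hDm] := compact_enorm_bounded cX.
pose N := omega / rho ^+ 2 + Num.sqrt L * Dm.
have N0 : 0 < N by rewrite ltr_pwDl ?divr_gt0 ?exprn_gt0// mulr_ge0 ?sqrtr_ge0 ?ltW.
pose e := Num.min 1 (eps / N).
have e0 : 0 < e by rewrite lt_min ltr01 divr_gt0.
have e1 : e <= 1 by rewrite ge_min lexx.
have eN : e * N <= eps by rewrite -ler_pdivlMr// ge_min lexx orbT.
have [k Dk] := residuals_get_small p0 sigma0 psig Bq_gt0 c0 rho0 rho1 omega0 omega1
  e0 (fun k => xs_min (Xx k)) Dpos (fun k => sqrtr_ge0 _) DS hF.
exists k.+1; apply: fw_gap_le => // v Xv.
have [_ _ hg _] := spec k.
have -> : grad f (pt (cur (s k.+1))) = - sprev (s k.+1) + res k.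
  by rewrite /res addrC addrK.
rewrite dotDl; apply: le_trans eN; rewrite /N mulrDr lerD//.
  apply: le_trans (hg v Xv) _.
  have Dk1 : rho * D k < e.
    by apply: le_lt_trans Dk; rewrite DS le_max lexx orbT.
  have BD : 0 < B * D k `^ sigma by rewrite mulr_gt0 ?Bq_gt0 ?powR_gt0.
  apply: (@le_trans _ _ (omega * D k ^+ 2)).
    rewrite ler_pdivrMr; last by rewrite addr_gt0.
    have b1 : 1 <= 1 + B * D k `^ sigma by rewrite lerDl ltW.
    have o0 : 0 <= omega * D k ^+ 2 by rewrite mulr_ge0 ?sqr_ge0 ?(ltW omega0).
    by rewrite ler_peMr.
  have -> : omega * D k ^+ 2 = omega / rho ^+ 2 * (rho * D k) ^+ 2.
    by field; rewrite gt_eqF.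
  rewrite [leRHS]mulrC ler_wpM2l ?divr_ge0 ?sqr_ge0 ?(ltW omega0)//.
  apply: (@le_trans _ _ (e ^+ 2)).
    by rewrite lerXn2r ?nnegrE ?mulr_ge0 ?(ltW e0) ?(ltW rho0) ?(ltW (Dpos _)) ?(ltW Dk1).
  by rewrite expr2 ler_piMl ?(ltW e0).
apply: le_trans (dot_le _ _) _.
have Xk1 : X (pt (cur (s k.+1))) := Xx k.+1.
rewrite mulrA ler_pM ?enorm_ge0// ?hDm//.
have h1 := dual_hnorm_lower mu0 (hb.1 _ (Xx k.+1)).1 L0 (hb.1 _ (Xx k.+1)).2 (res k).
have rD : r k <= e.
  by apply: le_trans (ltW Dk); rewrite DS le_max lexx.
rewrite -ler_sqr ?nnegrE ?enorm_ge0 ?mulr_ge0 ?sqrtr_ge0 ?(ltW e0)//.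
apply: le_trans h1 _; rewrite exprMn (sqr_sqrtr (ltW L0)) mulrC.
by rewrite ler_wpM2r ?(ltW L0)// lerXn2r ?nnegrE ?sqrtr_ge0 ?(ltW e0).
Qed.

End DampedPhase.

(** * Newton phase *)

Section NewtonPhase.
Context {R : realType} {n : nat}.

Lemma derive_line (F : 'rV[R]_n -> R) (u v : 'rV[R]_n) :
  'D_v F u = 'D_1 (fun s : R => F (u + s *: v)) 0.
Proof.
have E : (fun h : R => h^-1 *: ((F \o shift u) (h *: v) - F u)) =
    (fun h : R => h^-1 *:
      (((fun s : R => F (u + s *: v)) \o shift 0) (h *: 1) - F (u + 0 *: v))).
  apply/funext => h /=.
  by rewrite addr0 scale0r addr0 [h *: 1]mulr1 [u + _]addrC.
by rewrite /derive E.
Qed.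

Lemma Psi1E (f : 'rV[R]_n -> R) (x u : 'rV[R]_n) :
  (forall z, 0 <= dot (z *m hess f x) z) ->
  Psi1 f x u = f x + quad_model (grad f x) (hess f x) x u.
Proof. by move=> psd; rewrite /Psi1 sqr_hnorm// addrA. Qed.

Lemma dot_delta (G : 'rV[R]_n) i : dot G (delta_mx 0 i) = G 0 i.
Proof. by rewrite dotE trmx_delta -colE mxE. Qed.

Lemma grad_Psi1 (f : 'rV[R]_n -> R) (x u : 'rV[R]_n) : (hess f x)^T = hess f x ->
  (forall z, 0 <= dot (z *m hess f x) z) ->
  grad (Psi1 f x) u = grad f x + (u - x) *m hess f x.
Proof.
move=> sH psd; set G := _ + _; apply/rowP => i; rewrite gradE -dot_delta derive_line.
set v := delta_mx 0 i.
pose a := dot G v; pose b := dot (v *m hess f x) v / 2.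
pose c := f x + quad_model (grad f x) (hess f x) x u.
have -> : (fun s : R => Psi1 f x (u + s *: v)) = fun s : R => c + s * a + s ^+ 2 * b.
  apply/funext => s; rewrite Psi1E// quad_model_step// /c -/G -/a -/b.
  by generalize (quad_model (grad f x) (hess f x) x u) => ?; rewrite !addrA.
have d : is_derive (0 : R) 1 (fun s : R => c + s * a + s ^+ 2 * b) a.
  by apply: is_derive_eq; rewrite /GRing.scale /=; ring.
by rewrite derive_val.
Qed.

Section Step.
Variables (X : set 'rV[R]_n) (f : 'rV[R]_n -> R) (m : inner_proc).
Variables (mu L M : R) (xs : 'rV[R]_n).
Hypotheses (cX : compact X) (cvX : convex_set X) (tdf : twice_differentiable f).
Hypotheses (mu0 : 0 < mu) (L0 : 0 < L) (M0 : 0 < M) (hb : hess_bounds X f mu L M).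
Hypotheses (Xxs : X xs) (xs_min : forall y, X y -> f xs <= f y).

Let D := diameter X f.
Let C := C3 mu M D.

Lemma dist_le_diameter x : X x -> Num.sqrt mu * enorm (x - xs) <= D.
Proof.
move=> Xx; apply: (@le_trans _ _ (lnorm f x (x - xs))).
  rewrite -ler_sqr ?nnegrE ?mulr_ge0 ?sqrtr_ge0 ?enorm_ge0//.
  rewrite /lnorm sqr_hnorm; last exact: loewner_psd mu0 (hb.1 x Xx).1.
  by rewrite exprMn (sqr_sqrtr (ltW mu0)); exact: loewner_lower (hb.1 x Xx).1.
apply: sup_upper_bound; last by exists x, xs.
split; first by exists (lnorm f x (x - xs)), x, xs.
have [Dm Dm0 hDm] := compact_enorm_bounded cX.
exists (Num.sqrt L * Dm) => _ [y [z [Xy Xz ->]]].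
rewrite -ler_sqr ?nnegrE ?mulr_ge0 ?sqrtr_ge0 ?(ltW Dm0)//.
rewrite /lnorm sqr_hnorm; last exact: loewner_psd mu0 (hb.1 y Xy).1.
apply: le_trans (loewner_upper _ (hb.1 y Xy).2) _.
rewrite exprMn (sqr_sqrtr (ltW L0)) ler_wpM2l ?(ltW L0)//.
by rewrite lerXn2r ?nnegrE ?enorm_ge0 ?(ltW Dm0)// hDm.
Qed.

Lemma C3_gt0 : 0 < C.
Proof.
by rewrite /C /C3 ltr_pwDl ?divr_gt0 ?mulr_gt0// mulr_ge0 ?sqrtr_ge0 ?sqr_ge0.
Qed.

Lemma newton_step_spec s s' (x := pt (cur s)) (x' := pt (cur s')) :
  valid_iterate X m (cur s) -> newton_step X f m 4 s s' ->
  fw_gap X (grad f x) x != 0 ->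
  [/\ valid_iterate X m (cur s'),
    enorm (x' - xs) <= C * enorm (x - xs) ^+ 2 &
    f x' - f xs <= ((1 + M * D / (2 * mu `^ (3 / 2))) ^+ 4
       + M / 2 * (C * enorm (x - xs) + 1) ^+ 2 * C) * enorm (x - xs) ^+ 4].
Proof.
move=> val; rewrite /newton_step -/x => stp gap0; move: stp.
rewrite (negbTE gap0) => inner.
have Xx : X x := val.1.
have muH := (hb.1 x Xx).1.
have sH := loewner_sym muH.
have psd z := loewner_psd z mu0 muH.
have [val' qle [v _]] := inner_returns_spec cvX sH psd val inner.
rewrite /newton_test -/x -/x' in qle *.
rewrite grad_Psi1// Psi1E// opprD addrA subrr add0r => test.
have h0 : grad f x != 0.
  apply: contra_neq gap0 => ->; apply/eqP; rewrite eq_le fw_gap_ge0// andbT.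
  by apply: fw_gap_le => [|w _]; [exists xs|rewrite dot0l].
have dD := dist_le_diameter Xx.
split=> //.
  exact: (newton_step_dist cX cvX tdf mu0 M0 hb Xxs xs_min Xx dD val'.1 qle h0 test).
exact: (newton_step_value cX cvX tdf mu0 M0 hb Xxs xs_min Xx dD val'.1 qle h0 test).
Qed.

Lemma newton_step_valid s s' : valid_iterate X m (cur s) ->
  newton_step X f m 4 s s' -> valid_iterate X m (cur s').
Proof.
move=> val stp; have [g0|g0] := eqVneq (fw_gap X (grad f (pt (cur s))) (pt (cur s))) 0.
  by move: stp; rewrite /newton_step g0 eqxx => ->.
by have [] := newton_step_spec val stp g0.
Qed.

End Step.
End NewtonPhase.

Section Convergence.
Context {R : realType}.
Implicit Types (b e : nat -> R) (C T : R).

Lemma cvg0_halving b K : (forall k, 0 <= b k) ->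
  (forall k, (K <= k)%N -> b k.+1 <= 2^-1 * b k) -> b @ \oo --> (0 : R).
Proof.
move=> b0 half.
have bk k : b (k + K)%N <= b K * 2^-1 ^+ k.
  elim: k => [|k IH]; first by rewrite expr0 mulr1.
  rewrite addSn; apply: le_trans (half _ (leq_addl _ _)) _.
  by rewrite exprS mulrCA ler_wpM2l.
rewrite -(cvg_shiftn K); apply: (squeeze_cvgr (f := fun=> 0) (h := geometric (b K) 2^-1)).
- by near=> k; rewrite b0 bk.
- exact: cvg_cst.
- by apply: cvg_geometric; rewrite ger0_norm; lra.
Unshelve. all: by end_near. Qed.

Lemma cvg0_dominated b e T K p : (forall k, 0 <= e k) -> b @ \oo --> (0 : R) ->
  (forall k, (K <= k)%N -> e k.+1 <= T * b k ^+ p.+1) -> e @ \oo --> (0 : R).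
Proof.
move=> e0 cb eb; rewrite -cvg_shiftS.
apply: (squeeze_cvgr (f := fun=> 0) (h := fun k => T * b k ^+ p.+1)).
- by exists K => // k Kk /=; rewrite e0 eb.
- exact: cvg_cst.
suff : (fun k => T * b k ^+ p.+1) @ \oo --> T * 0 ^+ p.+1 by rewrite expr0n mulr0.
apply: cvgM; first exact: cvg_cst.
elim: p {eb} => [|p IH]; first exact: cb.
by under eq_fun do rewrite exprS; rewrite exprS; apply: cvgM.
Qed.

Lemma q_quadratic_of_bound b C K : 0 < C -> (forall k, 0 <= b k) -> b @ \oo --> (0 : R) ->
  (forall k, (K <= k)%N -> b k.+1 <= C * b k ^+ 2) -> q_quadratic b.
Proof. by move=> C0 b0 cb h; split=> //; exists C; split=> //; exists K. Qed.

End Convergence.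

Unset Implicit Arguments.

Theorem theorem3p9 (R : realType) (n : nat) (X : set 'rV[R]_n)
    (f : 'rV[R]_n -> R) (xs : 'rV[R]_n) (nu L3 : R) :
  X !=set0 -> compact X -> convex_set X ->
  convex_function setT f -> twice_differentiable f ->
  (forall x, X x -> posdef (hess f x)) ->
  X xs -> (forall y, X y -> f xs <= f y) ->
  0 <= nu <= 1 -> 0 < L3 -> holder3 X f nu L3 ->
  (exists mu L M : R, [/\ 0 < mu, 0 < L, 0 < M & hess_bounds X f mu L M]) /\
  forall (mu L M rho omega theta0 tau : R) (m : inner_proc)
    (x : nat -> 'rV[R]_n),
  let q := 3 + nu in
  let c3 : R := 4^-1 in
  let C := C3 mu M (diameter X f) in
  0 < mu -> 0 < L -> 0 < M -> hess_bounds X f mu L M ->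
  0 < rho < 1 ->
  0 < omega < c3 * mu / L * rho ^+ 2 * (1 - rho `^ (q / (q - 1))) ->
  0 < theta0 -> 1 < tau ->
  generated X f m q L3 c3 rho omega theta0 tau (K3 X f mu C x) 4 x ->
  exists K : nat, K3 X f mu C x = Some K /\
    ((exists k, x k = xs) \/
     [/\ forall k, (K <= k)%N ->
           enorm (x k.+1 - xs) <= C * enorm (x k - xs) ^+ 2,
         exists Ct : R, 0 < Ct /\ forall k, (K <= k)%N ->
           f (x k.+1) - f xs <= Ct * (f (x k) - f xs) ^+ 2,
         q_quadratic (fun k => enorm (x k - xs)) &
         q_quadratic (fun k => f (x k) - f xs)]).
Proof.
move=> X0 cX cvX _ tdf pd Xxs xs_min /andP[nu0 nu1] L30 [thr _ Gfin _].
split; first exact: (hess_bounds_exist X0 cX cvX thr Gfin pd).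
move=> mu L M rho omega theta0 tau m x q c3 C mu0 L0 M0 hb /andP[rho0 rho1].
move=> /andP[omega0 omega1] theta00 tau1 [s [xE st steps]].
have C0 : 0 < C by apply: (C3_gt0 X f).
have c30 : 0 < c3 by rewrite /c3.
have q2 : 2 < q by rewrite /q; lra.
have val0 := start_valid st.
have tb0 : 0 <= thetabar (s 0%N) by case: st => _ _ _ _ ->; exact: ltW.
have [K [KE gapK]] : exists K, K3 X f mu C x = Some K /\
    fw_gap X (grad f (x K)) (x K) <= mu / 8 * C ^- 2.
  rewrite /K3 /first_index in steps *; case: pselect steps => [ex _|nex steps].
    by case: ex_minnP => K gK _; exists K.
  have eps0 : 0 < mu / 8 * C ^- 2 by rewrite mulr_gt0 ?invr_gt0 ?exprn_gt0 ?divr_gt0.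
  have [k gk] := damped_gap_small cX cvX tdf mu0 L0 hb Xxs xs_min q2 L30
    c30 rho0 rho1 omega0 tau1 omega1 eps0 theta00 st steps.
  by case: nex; exists k; rewrite xE.
exists K; split=> //; rewrite KE /= in steps.
have val k : valid_iterate X m (cur (s k)) /\ ((k <= K)%N -> 0 <= thetabar (s k)).
  elim: k => [//|k [vk tk]]; have := steps k; case: leqP => [Kk stp|kK stp].
    split=> //.
    exact: (newton_step_valid cX cvX tdf mu0 L0 M0 hb Xxs xs_min vk stp).
  have [v t] := damped_step_valid cvX mu0 hb tau1 vk (tk (ltnW kK)) stp.
  by split.
have Xx k : X (x k) by rewrite xE; exact: (val k).1.1.
have [reach|noreach] := pselect (exists k, x k = xs); [by left|right].
pose d k := enorm (x k - xs); pose e k := f (x k) - f xs.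
have d0 k : 0 <= d k := enorm_ge0 _.
have e0 k : 0 <= e k by rewrite subr_ge0 xs_min.
set cf := 1 + M * diameter X f / (2 * mu `^ (3 / 2)).
have spec k : (K <= k)%N -> d k.+1 <= C * d k ^+ 2 /\
    e k.+1 <= (cf ^+ 4 + M / 2 * (C * d k + 1) ^+ 2 * C) * d k ^+ 4.
  move=> Kk; have := steps k; rewrite Kk => stp.
  have gap0 : fw_gap X (grad f (pt (cur (s k)))) (pt (cur (s k))) != 0.
    rewrite -xE; apply/eqP => /(minimizer_unique cX cvX tdf mu0 hb Xxs xs_min (Xx k)) xk.
    by apply: noreach; exists k.
  have [_ h1 h2] :=
    newton_step_spec cX cvX tdf mu0 L0 M0 hb Xxs xs_min (val k).1 stp gap0.
  by rewrite /d /e !xE.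
have CdK : C * d K <= 2^-1.
  rewrite -ler_sqr ?nnegrE ?mulr_ge0 ?(ltW C0)//.
  have := le_trans (gap_ge_dist cX cvX tdf mu0 hb Xxs xs_min (Xx K)) gapK.
  rewrite -/(d K) -mulrA ler_pM2l// => h.
  have : C ^+ 2 * d K ^+ 2 <= C ^+ 2 * (8^-1 * C ^- 2).
    by rewrite ler_wpM2l ?sqr_ge0.
  have -> : C ^+ 2 * (8^-1 * C ^- 2) = 8^-1 by field; rewrite gt_eqF.
  by rewrite exprMn => h1; apply: le_trans h1 _; lra.
have Cd k : (K <= k)%N -> C * d k <= 2^-1.
  move=> Kk; rewrite -(subnK Kk); elim: (k - K)%N => [//|j IH].
  rewrite addSn; have [h _] := spec _ (leq_addl j K).
  apply: le_trans (ler_wpM2l (ltW C0) h) _.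
  have Cd0 : 0 <= C * d (j + K)%N by rewrite mulr_ge0 ?(ltW C0).
  have -> : C * (C * d (j + K)%N ^+ 2) = (C * d (j + K)%N) * (C * d (j + K)%N) by ring.
  apply: le_trans (ler_wpM2l Cd0 IH) _.
  by rewrite ler_piMl ?invr_ge0// (le_trans IH)//; lra.
have dhalf k : (K <= k)%N -> d k.+1 <= 2^-1 * d k.
  move=> Kk; apply: le_trans (spec k Kk).1 _.
  by rewrite expr2 mulrA ler_wpM2r ?Cd.
have cd := cvg0_halving d0 dhalf.
pose T := cf ^+ 4 + M / 2 * 4 * C.
have T0 : 0 < T.
  by rewrite ltr_wpDl ?mulr_gt0 ?divr_gt0// (_ : 4 = 2 + 2)%N ?exprD -?expr2 ?sqr_ge0.
have eT k : (K <= k)%N -> e k.+1 <= T * d k ^+ 4.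
  move=> Kk; apply: le_trans (spec k Kk).2 _.
  rewrite ler_wpM2r ?exprn_ge0// lerD2l ler_wpM2r ?(ltW C0)//.
  rewrite ler_wpM2l ?divr_ge0 ?(ltW M0)//.
  have := Cd k Kk; have : 0 <= C * d k by rewrite mulr_ge0 ?(ltW C0).
  move: (C * d k) => t t0 t1.
  have -> : 4 = 2 ^+ 2 :> R by ring.
  by rewrite lerXn2r ?nnegrE; lra.
have eQ k : (K <= k)%N -> e k.+1 <= T * (16 / mu ^+ 2) * e k ^+ 2.
  move=> Kk; apply: le_trans (eT k Kk) _.
  rewrite -mulrA ler_wpM2l ?(ltW T0)//.
  have := quadratic_growth cvX tdf mu0 hb Xxs xs_min (Xx k).
  rewrite -/(d k) -/(e k) => h.
  have -> : d k ^+ 4 = 16 / mu ^+ 2 * (mu / 4 * d k ^+ 2) ^+ 2.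
    by field; rewrite gt_eqF.
  rewrite ler_wpM2l ?divr_ge0 ?sqr_ge0// lerXn2r ?nnegrE//.
  by rewrite mulr_ge0 ?sqr_ge0 ?divr_ge0 ?(ltW mu0).
have Ct0 : 0 < T * (16 / mu ^+ 2) by rewrite mulr_gt0 ?divr_gt0 ?exprn_gt0.
split.
- by move=> k Kk; exact: (spec k Kk).1.
- by exists (T * (16 / mu ^+ 2)); split.
- exact: (q_quadratic_of_bound C0 d0 cd (fun k Kk => (spec k Kk).1)).
- exact: (q_quadratic_of_bound Ct0 e0 (cvg0_dominated e0 cd eT) eQ).
Qed.
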